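(* On $\mathbb{R}^{2n}$ with coordinates $(x_1,y_1,\dots,x_n,y_n)$ and $\omega=\sum_{i=1}^n\mathrm{d}x_i\wedge\mathrm{d}y_i$, let $h_i=x_i^2+y_i^2$ for all $i=1,\dots,n$ (all vector fields of elliptic type), with Hamiltonian vector fields $X_i=2(-y_i\partial_{x_i}+x_i\partial_{y_i})$. Then for $k=1,\dots,n$, $$\ker\big(\mathrm{d}_{\mathcal{F}}:\Omega^k_{\mathcal{F}}(\mathbb{R}^{2n})\to\Omega^{k+1}_{\mathcal{F}}(\mathbb{R}^{2n})\big)=W^k_{\mathcal{F}}(\mathbb{R}^{2n})\oplus\mathrm{d}_{\mathcal{F}}\big(\Omega^{k-1}_{\mathcal{F}}(\mathbb{R}^{2n})\big),$$ where $W^k_{\mathcal{F}}(\mathbb{R}^{2n})$ is the set of $\beta\in\Omega^k_{\mathcal{F}}(\mathbb{R}^{2n})$ with $\pounds_{X_i}\beta=0$ for all $i$. Consequently $$H^k_{\mathcal{F}}(\mathbb{R}^{2n})\cong\bigoplus_{1\le j_1<\cdots<j_k\le n}\Big\{f_{j_1\cdots j_k}\in C^\infty(\mathbb{R}^{2n}) : \exists f \text{ with } f_{j_1\cdots j_k}(p)=f(h_1(p),\dots,h_n(p))\ \forall p, \text{ and } f_{j_1\cdots j_k}|_{\Sigma_{j_1}\cup\cdots\cup\Sigma_{j_k}}=0\Big\},$$ a direct sum of $\binom{n}{k}$ summands.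
   Context: $\mathcal{F}$ is the $C^\infty(\mathbb{R}^{2n})$-module generated by the commuting vector fields $X_1,\dots,X_n$; $\Omega^k_{\mathcal{F}}(\mathbb{R}^{2n})=\mathrm{Hom}_{C^\infty}(\wedge^k_{C^\infty}\mathcal{F};C^\infty(\mathbb{R}^{2n}))$ (with $\Omega^0_{\mathcal{F}}=C^\infty(\mathbb{R}^{2n})$, $\Omega^{n+1}_{\mathcal{F}}=0$), with differential $\mathrm{d}_{\mathcal{F}}\alpha(Y_1,\dots,Y_{k+1})=\sum_i(-1)^{i+1}Y_i(\alpha(\dots,\hat Y_i,\dots))+\sum_{i<j}(-1)^{i+j}\alpha([Y_i,Y_j],\dots,\hat Y_i,\dots,\hat Y_j,\dots)$; $H^k_{\mathcal{F}}$ is the cohomology of this complex. $(\pounds_{X_i}\beta)(X_{j_1},\dots,X_{j_k})=X_i(\beta(X_{j_1},\dots,X_{j_k}))$. $\Sigma_i=\{x_i=y_i=0\}$. *)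

(* Defs.v *)
From HB Require Import structures.
From mathcomp Require Import all_boot all_order all_algebra.
From mathcomp Require Import all_classical all_reals all_analysis.
Set Implicit Arguments. Unset Strict Implicit. Unset Printing Implicit Defensive.
Import Order.TTheory GRing.Theory Num.Theory.
Import numFieldNormedType.Exports.
Local Open Scope ring_scope.

Definition pt (R : realType) (n : nat) := 'rV[R]_(n + n).

Section Defs.
Variables (R : realType).

Fixpoint Ck (m k : nat) (f : 'rV[R]_m -> R) : Prop :=
  match k with
  | 0 => continuous f
  | k'.+1 => (forall x, differentiable f x) /\
             (forall j : 'I_m, Ck k' (fun x => 'D_(delta_mx 0 j) f x))
  end.

Definition smooth (m : nat) (f : 'rV[R]_m -> R) : Prop := forall k, Ck k f.

Variable n : nat.

Definition ex (i : 'I_n) : pt R n := delta_mx 0 (lshift n i).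
Definition ey (i : 'I_n) : pt R n := delta_mx 0 (rshift n i).
Definition xc (i : 'I_n) (p : pt R n) : R := p 0 (lshift n i).
Definition yc (i : 'I_n) (p : pt R n) : R := p 0 (rshift n i).

Definition hh (i : 'I_n) (p : pt R n) : R := xc i p ^+ 2 + yc i p ^+ 2.
Definition hvec (p : pt R n) : 'rV[R]_n := \row_i hh i p.

Definition Xf (i : 'I_n) (f : pt R n -> R) : pt R n -> R :=
  fun p => 2 * (- yc i p * 'D_(ex i) f p + xc i p * 'D_(ey i) f p).

Definition Sigma (i : 'I_n) : set (pt R n) :=
  [set p | xc i p = 0 /\ yc i p = 0].

(* A foliated cochain is represented by its values on the generators:
   a J = alpha(X_{j_1}, ..., X_{j_k}) for J = {j_1 < ... < j_k}. *)
Definition cochain := {set 'I_n} -> pt R n -> R.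

Definition is_form (k : nat) (a : cochain) : Prop :=
  forall J : {set 'I_n},
    (#|J| = k -> smooth (a J)) /\ (#|J| <> k -> a J = (fun _ => 0)).

(* d_F: the bracket terms vanish since [X_i, X_j] = 0 *)
Definition dF (a : cochain) : cochain :=
  fun J p => \sum_(j in J)
     (-1) ^+ #|[set i in J | (val i < val j)%N]| * Xf j (a (J :\ j)) p.

Definition closedF (k : nat) (a : cochain) : Prop :=
  is_form k a /\ forall J, dF a J = (fun _ => 0).

Definition exactF (k : nat) (a : cochain) : Prop :=
  exists b, is_form k.-1 b /\ a = dF b.

Definition Wk (k : nat) (b : cochain) : Prop :=
  is_form k b /\ forall (i : 'I_n) J, Xf i (b J) = (fun _ => 0).

Definition summand (J : {set 'I_n}) (g : pt R n -> R) : Prop :=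
  smooth g /\ (exists f : 'rV[R]_n -> R, forall p, g p = f (hvec p)) /\
  (forall p, (exists j, j \in J /\ Sigma j p) -> g p = 0).

Definition in_dsum (k : nat) (G : cochain) : Prop :=
  forall J : {set 'I_n},
    (#|J| = k -> summand J (G J)) /\ (#|J| <> k -> G J = (fun _ => 0)).

End Defs.

(* Main.v *)
Require Import Defs.
From HB Require Import structures.
From mathcomp Require Import all_boot all_order all_algebra.
From mathcomp Require Import all_classical all_reals all_analysis.
From mathcomp Require Import ring lra.
Set Implicit Arguments. Unset Strict Implicit. Unset Printing Implicit Defensive.
Import Order.TTheory GRing.Theory Num.Theory.
Import numFieldNormedType.Exports.
Local Open Scope classical_set_scope.
Local Open Scope ring_scope.

(** The flow of X_i is periodic, so every smooth f splits as
    f = A_i f + P_i X_i f, where A_i averages f over the orbits of X_i and P_i is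
    a weighted average with X_i P_i = P_i X_i = 1 - A_i.  Both operators commute
    with every X_j, hence with d_F, and Cartan's formula X_i = d i_{X_i} + i_{X_i} d
    shows that a closed form a differs from A_i a by the exact form
    d (i_{X_i} P_i a).  Averaging over all i gives an invariant representative,
    which vanishes when a is exact because the average of d b is d of an
    invariant form.  Invariant functions are exactly the functions of
    (h_1, ..., h_n); multiplying the J-component by the product of the h_j,
    j in J, identifies them with those vanishing on the Sigma_j, since an
    invariant function vanishing on Sigma_j is smoothly divisible by h_j. *)

(** * Integrals over [[0, 1]] depending on a parameter *)

(** The obstacle is smoothness: it is an iterated condition on coordinate partials, so every
    operator has to be differentiated under an integral sign to all orders. Averages, primitives and
    quotients by [h_j] are therefore all given one shape, the integral over [[0, 1]] of
    [phi t * f (p *m L t)] with [L t] a matrix: rotations for the first two, contractions onto a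
    coordinate subspace for the quotients. A partial derivative of such an integral is a finite sum
    of integrals of the same shape, so a single induction settles all cases. Cochains being stored
    by their values on the generators, an operator on functions acts componentwise, and the
    identities of the complex reduce to commutation with the [X_j] and to signs. Identities obtained
    after multiplication by [h_j] are freed of this factor by density: [h_j] is nonzero off
    [Sigma_j], and continuity does the rest. *)

Lemma cvg_sum (R : realType) (V : normedModType R) T (F : set_system T) n
    (f : 'I_n -> T -> V) (l : 'I_n -> V) : Filter F ->
  (forall i, f i x @[x --> F] --> l i) ->
  \sum_i f i x @[x --> F] --> \sum_i l i.
Proof. by move=> FF cf; apply: cvg_big => //; exact: add_continuous. Qed.

Section UnitIntegral.
Variable R : realType.
Implicit Types f g : R -> R.

Definition I01 (f : R -> R) : R :=
  (\int[@lebesgue_measure R]_(t in `[0%R, 1%R]) f t)%R.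

Lemma I01_integrable f : continuous f ->
  (@lebesgue_measure R).-integrable `[0%R, 1%R] (EFin \o f).
Proof.
move=> cf; apply: continuous_compact_integrable; first exact: segment_compact.
exact: continuous_subspaceT.
Qed.

Lemma I01D f g : continuous f -> continuous g ->
  I01 (fun t => f t + g t) = I01 f + I01 g.
Proof. by move=> cf cg; apply: RintegralD => //; exact: I01_integrable. Qed.

Lemma I01Z (c : R) f : continuous f -> I01 (fun t => c * f t) = c * I01 f.
Proof. by move=> cf; apply: RintegralZl => //; exact: I01_integrable. Qed.

Lemma I01_cst (c : R) : I01 (fun=> c) = c.
Proof.
rewrite /I01 Rintegral_cst// [X in fine X](_ : _ = 1%:E) ?mulr1//.
have := @lebesgue_measure_itv R `[0, 1]; rewrite /= => ->.
by rewrite lte_fin ltr01 -EFinB subr0.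
Qed.

Lemma eq_I01 f g : {in `[0, 1], f =1 g} -> I01 f = I01 g.
Proof. by move=> fg; apply: eq_Rintegral => t; rewrite inE => /fg. Qed.

Lemma I01B f g : continuous f -> continuous g ->
  I01 (fun t => f t - g t) = I01 f - I01 g.
Proof. by move=> cf cg; apply: RintegralB => //; exact: I01_integrable. Qed.

Lemma I01_sum n (f : 'I_n -> R -> R) : (forall i, continuous (f i)) ->
  I01 (fun t => \sum_i f i t) = \sum_i I01 (f i).
Proof.
elim: n f => [|n IH] f cf.
  rewrite big_ord0 -[RHS](I01_cst 0); apply: eq_I01 => t _.
  by rewrite big_ord0.
rewrite big_ord_recl -IH//.
under eq_I01 => t _ do rewrite big_ord_recl.
rewrite I01D// => t; apply: cvg_sum => i; exact: cf.
Qed.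

Lemma I01_norm_le f (M : R) : continuous f ->
  {in `[0, 1], forall t, `|f t| <= M} -> `|I01 f| <= M.
Proof.
move=> cf fM.
apply: le_trans (le_normr_Rintegral _ (I01_integrable cf)) _ => //.
rewrite -[leRHS]I01_cst; apply: le_Rintegral => //.
- by apply: I01_integrable => t; apply: cvg_norm; exact: cf.
- by apply: I01_integrable => t; exact: cvg_cst.
Qed.

Lemma I01_FTC2 (F f : R -> R) : continuous f ->
  (forall t : R, is_derive t 1 F (f t)) -> I01 f = F 1 - F 0.
Proof.
move=> cf dF; rewrite /I01 /Rintegral (@continuous_FTC2 _ f F 0 1)//.
- exact: continuous_subspaceT.
- have cF t : F x @[x --> t] --> F t.
    by apply: differentiable_continuous; apply/derivable1_diffP.
  split => [t _||]; first by [].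
  + exact: cvg_at_right_filter.
  + exact: cvg_at_left_filter.
- by move=> t _; rewrite derive1E; exact: derive_val.
Qed.

End UnitIntegral.

Lemma is_derive_curve (R : realType) m (f : 'rV[R]_m -> R) (c : R -> 'rV[R]_m)
    (c' : 'rV[R]_m) (t : R) :
  differentiable f (c t) -> is_derive t 1 c c' ->
  is_derive t 1 (f \o c) ('D_c' f (c t)).
Proof.
move=> df dc.
have Dc : differentiable c t by apply/derivable1_diffP; exact: ex_derive.
have dfc : differentiable (f \o c) t by exact: differentiable_comp.
apply: DeriveDef; first exact: diff_derivable.
rewrite deriveE// diff_comp//= [RHS]deriveE//; congr ('d f _ _).
by rewrite -deriveE// derive_val.
Qed.

Lemma differentiable_of_bound (K : numFieldType) (V W : normedModType K)
    (f : V -> W) (L : {linear V -> W}) (p : V) : continuous L ->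
  (forall e, 0 < e -> \forall h \near 0, `|f (h + p) - f p - L h| <= e * `|h|) ->
  differentiable f p /\ 'd f p = L :> (V -> W).
Proof.
move=> cL fL.
have E : f \o shift p = cst (f p) + L +o_ 0 id.
  apply/eqaddoP => e e0; apply: filterS (fL e e0) => h.
  by rewrite !fctE /= opprD addrA.
have dE : 'd f p = L :> (V -> W) by exact: diff_unique.
by split=> //; apply/diff_locallyP; rewrite dE.
Qed.

(** * Differentiation under the integral sign *)

Section UnderIntegral.
Variables (R : realType) (m : nat).
Notation V := 'rV[R]_m.

(** Compactness of [[0, 1]]: near each [(t0, p0)] joint continuity brings both [G t p] and [G t p0]
    close to [G t0 p0], and a finite cover gives one neighbourhood of [p0] for all [t]. *)
Lemma near_unif01 (G : R -> V -> R) (p0 : V) (e : R) : 0 < e ->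
  continuous (fun z : R * V => G z.1 z.2) ->
  \forall p \near p0, {in `[0, 1], forall t, `|G t p - G t p0| <= e}.
Proof.
move=> e0 cG.
have K := (compact_near_coveringP _).1 (@segment_compact R 0 1).
have := K _ (nbhs p0) (fun p t => `|G t p - G t p0| <= e) _.
apply => t0 _.
have e2 : 0 < e / 2 by rewrite divr_gt0.
have /cvgrPdist_lt/(_ _ e2)[[A B] /= [A0 B0] AB] := cG (t0, p0).
exists (A, B) => //= -[t p] [/= At Bp].
have h1 := AB (t, p) (conj At Bp).
have h2 := AB (t, p0) (conj At (nbhs_singleton B0)).
rewrite /= in h1 h2.
rewrite -(subrKA (G t0 p0)) (le_trans (ler_normD _ _))// (splitr e) lerD//.
  by rewrite distrC ltW.
exact: ltW.
Qed.

Lemma continuous_slice (G : R -> V -> R) (p : V) :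
  continuous (fun z : R * V => G z.1 z.2) -> continuous (G^~ p).
Proof.
move=> cG t.
apply: (@cvg_comp _ _ _ (fun s => (s, p)) (fun z => G z.1 z.2) _ (nbhs (t, p))).
  exact: (cvg_pair (F := nbhs t) (G := nbhs t) (H := nbhs p) cvg_id (cvg_cst p)).
exact: (cG (t, p)).
Qed.

Lemma I01_continuous (G : R -> V -> R) :
  continuous (fun z : R * V => G z.1 z.2) -> continuous (fun p => I01 (G^~ p)).
Proof.
move=> cG p0; apply/(@cvgrPdist_le _ _ _ (nbhs p0)) => e e0.
apply: filterS (near_unif01 p0 e0 cG) => p h.
rewrite -I01B; [|exact: continuous_slice..].
apply: I01_norm_le => [t|t t01]; last by rewrite distrC h.
by apply: cvgB; apply: continuous_slice.
Qed.

Lemma derive_sum_coord (f : V -> R) p v : differentiable f p ->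
  'D_v f p = \sum_j v 0 j * 'D_(delta_mx 0 j) f p.
Proof.
move=> df; rewrite deriveE// {1}(row_sum_delta v) linear_sum.
by apply: eq_bigr => j _; rewrite linearZ/= deriveE.
Qed.

Lemma coord_le_norm (v : V) j : `|v 0 j| <= `|v|.
Proof.
rewrite [leRHS]/Num.Def.normr/= mx_normrE.
exact: (le_bigmax _ (fun ij => `|v ij.1 ij.2|) (0, j)).
Qed.

Lemma is_derive_line (f : V -> R) (p v : V) (t : R) :
  (forall x, differentiable f x) ->
  is_derive t 1 (fun s => f (p + s *: v)) ('D_v f (p + t *: v)).
Proof.
move=> df.
have dc : is_diff t (cst p + ( *:%R ^~ v) : R -> V) (0 + *:%R ^~ v).
  exact: is_diffD.
have dc1 : is_derive t 1 (cst p + ( *:%R ^~ v) : R -> V) v.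
  apply: DeriveDef; first by apply: diff_derivable; exact: ex_diff.
  by rewrite deriveE ?diff_val; [rewrite add0r scale1r|exact: ex_diff].
exact: (is_derive_curve (df _) dc1).
Qed.

(** The mean value theorem on the segment from [p] to [h + p], with the directional derivative
    expanded in coordinates; [m%:R] counts them. The bound involves only partial derivatives, so it
    is uniform in a parameter as soon as they are. *)
Lemma first_order_bound (f : V -> R) (p h : V) (e : R) :
  (forall x, differentiable f x) ->
  (forall q j, `|q - p| <= `|h| ->
    `|'D_(delta_mx 0 j) f q - 'D_(delta_mx 0 j) f p| <= e) ->
  `|f (h + p) - f p - 'D_h f p| <= m%:R * e * `|h|.
Proof.
move=> df he.
have [c c01] : exists2 c, c \in `]0, 1[%R &
    f (p + 1 *: h) - f (p + 0 *: h) = 'D_h f (p + c *: h) * (1 - 0).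
  apply: (@MVT R (fun s => f (p + s *: h)) (fun s => 'D_h f (p + s *: h)) 0 1).
  - exact: ltr01.
  - by move=> s _; exact: is_derive_line.
  - apply: derivable_within_continuous => s _.
    by have [] := is_derive_line p h s df.
rewrite scale1r scale0r addr0 subr0 mulr1 (addrC h) => ->.
rewrite !derive_sum_coord// -sumrB.
apply: le_trans (ler_norm_sum _ _ _) _.
have -> : m%:R * e * `|h| = \sum_(j < m) e * `|h|.
  by rewrite sumr_const card_ord -mulrA mulr_natl.
apply: ler_sum => j _; rewrite -mulrBr normrM mulrC ler_pM ?coord_le_norm//.
apply: he; rewrite addrAC subrr add0r normrZ ler_piMl//.
by move: c01; rewrite in_itv/= => /andP[c0 c1]; rewrite ger0_norm ltW.
Qed.

(** The candidate differential is [v -> I01 (fun t => 'D_v (G t) p)]. Its remainder is the integral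
    of the remainders of the [G t], which [first_order_bound] controls uniformly in [t] once
    [near_unif01] is applied to the partials. *)
Lemma I01_diff (G : R -> V -> R) (p : V) :
  (forall t x, differentiable (G t) x) ->
  continuous (fun z : R * V => G z.1 z.2) ->
  (forall j, continuous (fun z : R * V => 'D_(delta_mx 0 j) (G z.1) z.2)) ->
  differentiable (fun q => I01 (G^~ q)) p /\
  forall v, 'D_v (fun q => I01 (G^~ q)) p = I01 (fun t => 'D_v (G t) p).
Proof.
move=> dG cG cDG; set F := fun q => I01 (G^~ q).
have cDv v : continuous (fun t => 'D_v (G t) p).
  under [X in continuous X]eq_fun => t do rewrite derive_sum_coord//.
  move=> t; apply: cvg_sum => j; apply: cvgM; first exact: cvg_cst.
  exact: (@continuous_slice (fun t x => 'D_(delta_mx 0 j) (G t) x) p (cDG j)).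
pose d (v : V) : R := I01 (fun t => 'D_v (G t) p).
have dE v : d v = \sum_j v 0 j * d (delta_mx 0 j).
  rewrite /d; under eq_I01 => t _ do rewrite derive_sum_coord//.
  rewrite I01_sum => [|j t].
    by apply: eq_bigr => j _; rewrite I01Z//; exact: cDv.
  by apply: cvgM; [exact: cvg_cst|exact: cDv].
have d_lin : linear d.
  move=> a u w; rewrite !(dE (_ + _)) (dE u) (dE w) scaler_sumr -big_split/=.
  by apply: eq_bigr => j _; rewrite !mxE mulrDl [_ *: _]mulrA.
pose dM := GRing.isLinear.Build _ _ _ _ _ d_lin.
pose dL : {linear V -> R} := HB.pack d dM.
have cd : continuous dL.
  rewrite /dL/= (_ : d = fun v => \sum_j v 0 j * d (delta_mx 0 j)); last first.
    by apply/funext => v; rewrite dE.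
  move=> v; apply: (@cvg_sum _ _ _ (nbhs v)) => j.
  apply: (@cvgM _ _ (nbhs v)); last exact: cvg_cst.
  exact: coord_continuous.
have Fd e : 0 < e -> \forall h \near (0 : V),
    `|F (h + p) - F p - dL h| <= e * `|h|.
  (* [m.+1] rather than [m]: the divisor stays nonzero when [m = 0], and [m%:R * e' <= e] still
     holds. *)
  move=> e0; pose e' := e / m.+1%:R.
  have e'0 : 0 < e' by rewrite divr_gt0.
  pose U (j : 'I_m) := [set q : V | {in `[0, 1], forall t,
     `|'D_(delta_mx 0 j) (G t) q - 'D_(delta_mx 0 j) (G t) p| <= e'}].
  have : \forall q \near p, forall j, U j q.
    apply: (@filter_forall _ _ U (nbhs p) _) => j.
    exact: (@near_unif01 (fun t => 'D_(delta_mx 0 j) (G t)) p e' e'0 (cDG j)).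
  move=> /nbhs_normP[r /= r0 rP].
  apply/nbhs_normP; exists r => //= h; rewrite /ball_/= sub0r normrN => hr.
  rewrite [X in `|X|](_ : _ =
    I01 (fun t => G t (h + p) - G t p - 'D_h (G t) p)); last first.
    rewrite I01B; [|move=> t; apply: cvgB; exact: continuous_slice|exact: cDv].
    by rewrite I01B; [|exact: continuous_slice..].
  apply: I01_norm_le => [t|t t01].
    apply: cvgB; last exact: cDv.
    by apply: cvgB; exact: continuous_slice.
  apply: le_trans (@first_order_bound (G t) p h e' _ _) _ => //.
    move=> q j qp; apply: rP t t01.
    by rewrite /ball_/= distrC (le_lt_trans qp).
  rewrite ler_wpM2r// /e' mulrCA ger_pMr// ler_pdivrMr// mul1r ler_nat.
  exact: leqW.
have [DF dF] := differentiable_of_bound cd Fd.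
by split=> // v; rewrite deriveE// dF.
Qed.

End UnderIntegral.

(** * Smooth functions *)

Section SmoothAlgebra.
Variables (R : realType) (m : nat).
Notation V := 'rV[R]_m.
Implicit Types (f g : V -> R) (p v : V) (k : nat).

Lemma Ck_pred k f : Ck k.+1 f -> Ck k f.
Proof.
elim: k f => [|k IH] f [df pf]; first by move=> x; exact: differentiable_continuous.
by split=> // j; exact/IH/pf.
Qed.

Lemma Ck_continuous k f : Ck k f -> continuous f.
Proof. by elim: k => // k IH /Ck_pred. Qed.

Lemma eq_Ck k f g : g =1 f -> Ck k f -> Ck k g.
Proof. by move=> /funext ->. Qed.

Lemma Ck_cst k (c : R) : Ck k (fun _ : V => c).
Proof.
elim: k c => [|k IH] c; first exact: cst_continuous.
split=> [x|j]; first exact: differentiable_cst.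
apply: eq_Ck (IH 0) => x; exact: derive_cst.
Qed.

Lemma CkD k f g : Ck k f -> Ck k g -> Ck k (fun p => f p + g p).
Proof.
elim: k f g => [|k IH] f g; first by move=> cf cg x; exact: continuousD (cf x) (cg x).
move=> [df pf] [dg pg]; split=> [x|j]; first exact: differentiableD.
apply: (@eq_Ck _ (fun x => 'D_(delta_mx 0 j) f x + 'D_(delta_mx 0 j) g x)) => [x|].
  by rewrite deriveD//; exact: diff_derivable.
by apply: IH; [exact: pf|exact: pg].
Qed.

Lemma CkM k f g : Ck k f -> Ck k g -> Ck k (fun p => f p * g p).
Proof.
elim: k f g => [|k IH] f g; first by move=> cf cg x; exact: continuousM (cf x) (cg x).
move=> cf cg; have [df pf] := cf; have [dg pg] := cg.
split=> [x|j]; first exact: differentiableM.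
apply: (@eq_Ck _ (fun x => f x * 'D_(delta_mx 0 j) g x +
                           g x * 'D_(delta_mx 0 j) f x)) => [x|].
  by rewrite deriveM//; exact: diff_derivable.
by apply: CkD; apply: IH; [exact: Ck_pred cf|exact: pg|exact: Ck_pred cg|exact: pf].
Qed.

Lemma Ck_coord k j : Ck k (fun p : V => p 0 j).
Proof.
case: k => [|k]; first exact: coord_continuous.
split=> [x|i]; first exact: differentiable_coord.
apply: eq_Ck (Ck_cst k (j == i)%:R) => x.
rewrite deriveE; last exact: differentiable_coord.
have L : linear (fun p : V => p 0 j) by move=> a u w; rewrite !mxE.
pose M := GRing.isLinear.Build _ _ _ _ _ L.
pose l : {linear V -> R} := HB.pack (fun p : V => p 0 j) M.
rewrite (@diff_lin _ _ _ l) /=; last exact: coord_continuous.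
by rewrite mxE eqxx.
Qed.

Lemma Ck_sum k n (f : 'I_n -> V -> R) : (forall i, Ck k (f i)) ->
  Ck k (fun p => \sum_i f i p).
Proof.
elim: n f => [|n IH] f cf.
  under eq_fun do rewrite big_ord0.
  exact: Ck_cst.
by under eq_fun do rewrite big_ord_recl; apply: CkD => //; exact: IH.
Qed.

Lemma smooth_differentiable f p : smooth f -> differentiable f p.
Proof. by move=> /(_ 1)[]. Qed.

Lemma smooth_derivable f p v : smooth f -> derivable f p v.
Proof. by move=> sf; exact/diff_derivable/smooth_differentiable. Qed.

Lemma smooth_continuous f : smooth f -> continuous f.
Proof. by move/(_ 0). Qed.

Lemma smooth_cst (c : R) : smooth (fun _ : V => c).
Proof. by move=> k; exact: Ck_cst. Qed.

Lemma smoothD f g : smooth f -> smooth g -> smooth (fun p => f p + g p).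
Proof. by move=> sf sg k; exact: CkD. Qed.

Lemma smoothM f g : smooth f -> smooth g -> smooth (fun p => f p * g p).
Proof. by move=> sf sg k; exact: CkM. Qed.

Lemma smoothZ (c : R) f : smooth f -> smooth (fun p => c * f p).
Proof. by move=> sf; apply: smoothM => //; exact: smooth_cst. Qed.

Lemma smoothB f g : smooth f -> smooth g -> smooth (fun p => f p - g p).
Proof.
move=> sf sg; under eq_fun do rewrite -mulN1r.
by apply: smoothD => //; exact: smoothZ.
Qed.

Lemma smooth_coord j : smooth (fun p : V => p 0 j).
Proof. by move=> k; exact: Ck_coord. Qed.

Lemma smooth_prod (I : Type) (r : seq I) (P : pred I) (f : I -> V -> R) :
  (forall i, smooth (f i)) -> smooth (fun p => \prod_(i <- r | P i) f i p).
Proof.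
move=> sf; elim: r => [|i r IH].
  by under eq_fun do rewrite big_nil; exact: smooth_cst.
under eq_fun do rewrite big_cons.
by case: (P i) => //; exact: smoothM.
Qed.

Lemma smooth_sum (I : Type) (r : seq I) (P : pred I) (f : I -> V -> R) :
  (forall i, smooth (f i)) -> smooth (fun p => \sum_(i <- r | P i) f i p).
Proof.
move=> sf; elim: r => [|i r IH].
  by under eq_fun do rewrite big_nil; exact: smooth_cst.
under eq_fun do rewrite big_cons.
by case: (P i) => //; exact: smoothD.
Qed.

Lemma smooth_partial f j : smooth f -> smooth (fun p => 'D_(delta_mx 0 j) f p).
Proof. by move=> sf k; exact: (sf k.+1).2. Qed.

End SmoothAlgebra.

(** * Integral operators along curves of linear maps *)

Section LinearFamily.
Variables (R : realType) (m : nat).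
Notation V := 'rV[R]_m.
Implicit Types (f g : V -> R) (p v : V) (phi : R -> R).

Lemma continuous_mulmx_family (L : R -> 'M[R]_m) :
  (forall i j, continuous (fun t => L t i j)) ->
  continuous (fun z : R * V => z.2 *m L z.1).
Proof.
move=> cL.
rewrite (_ : (fun _ => _) = fun z : R * V =>
    \sum_j (\sum_i z.2 0 i * L z.1 i j) *: (delta_mx 0 j : V)); last first.
  by apply/funext => z; rewrite {1}(row_sum_delta (z.2 *m L z.1));
     apply: eq_bigr => j _; rewrite mxE.
move=> z; apply: (@cvg_sum _ _ _ (nbhs z)) => j.
apply: (@cvgZr_tmp _ _ _ (nbhs z)).
apply: (@cvg_sum _ _ _ (nbhs z)) => i.
apply: (@cvgM _ _ (nbhs z)).
- apply: (@cvg_comp _ _ _ snd (fun p : V => p 0 i) (nbhs z) (nbhs z.2)).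
    exact: cvg_snd.
  exact: coord_continuous.
- apply: (@cvg_comp _ _ _ fst (fun t => L t i j) (nbhs z) (nbhs z.1)).
    exact: cvg_fst.
  exact: cL.
Qed.

Lemma continuous_mulmxr (M : 'M[R]_m) : continuous (fun p : V => p *m M).
Proof.
have := @continuous_mulmx_family (fun=> M) (fun i j => @cst_continuous _ _ (M i j)).
move=> cM p.
apply: (@cvg_comp _ _ _ (fun q : V => (0 : R, q)) (fun z => z.2 *m M) _
  (nbhs (0 : R, p))).
  exact: (cvg_pair (F := nbhs p) (G := nbhs (0 : R)) (H := nbhs p) (cvg_cst _) cvg_id).
exact: (cM (0, p)).
Qed.

Lemma differentiable_mulmxr f (M : 'M[R]_m) p : differentiable f (p *m M) ->
  differentiable (fun q => f (q *m M)) p.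
Proof.
move=> df; apply: (@differentiable_comp _ _ _ _ (mulmxr M) f) => //.
by apply: linear_differentiable; exact: continuous_mulmxr.
Qed.

Lemma derive_mulmxr f (M : 'M[R]_m) p v : differentiable f (p *m M) ->
  'D_v (fun q => f (q *m M)) p = 'D_(v *m M) f (p *m M).
Proof.
move=> df; rewrite deriveE ?(deriveE _ df); last exact: differentiable_mulmxr.
have dM : differentiable (mulmxr M : V -> V) p.
  by apply: linear_differentiable; exact: continuous_mulmxr.
have -> : v *m M = 'd (mulmxr M : V -> V) p v.
  by rewrite (@diff_lin _ _ _ (mulmxr M : {linear V -> V}))//; exact: continuous_mulmxr.
exact: (congr1 (fun h => h v) (diff_comp dM df)).
Qed.

(** Points are row vectors, so [L t] acts on the right. The weight [phi] is kept general because
    differentiating in [p] multiplies it by entries of [L t]. *)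
Definition Iop phi (L : R -> 'M[R]_m) f : V -> R :=
  fun p => I01 (fun t => phi t * f (p *m L t)).

Variable L : R -> 'M[R]_m.
Hypothesis cL : forall i j, continuous (fun t => L t i j).

Lemma continuous_Iop_arg phi f : continuous phi -> continuous f ->
  continuous (fun z : R * V => phi z.1 * f (z.2 *m L z.1)).
Proof.
move=> cphi cf z; apply: (@cvgM _ _ (nbhs z)).
- apply: (@cvg_comp _ _ _ fst phi (nbhs z) (nbhs z.1)); first exact: cvg_fst.
  exact: cphi.
- apply: (@cvg_comp _ _ _ (fun z => z.2 *m L z.1) f (nbhs z) (nbhs (z.2 *m L z.1))).
    exact: continuous_mulmx_family.
  exact: cf.
Qed.

Lemma continuous_Iop_slice phi f p : continuous phi -> continuous f ->
  continuous (fun t => phi t * f (p *m L t)).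
Proof.
move=> cphi cf.
exact: (@continuous_slice _ _ (fun t q => phi t * f (q *m L t)) p
  (continuous_Iop_arg cphi cf)).
Qed.

Lemma derive_Iop_arg phi f v t p : differentiable f (p *m L t) ->
  'D_v (fun q => phi t * f (q *m L t)) p = phi t * 'D_(v *m L t) f (p *m L t).
Proof.
move=> df; rewrite -derive_mulmxr//.
by apply: (@deriveZ _ _ _ (fun q => f (q *m L t)));
  apply/diff_derivable/differentiable_mulmxr.
Qed.

(** Stated for [Ck 1], since the induction in [Ck_Iop] controls only finitely many derivatives at a
    time. *)
Lemma Iop_diff phi f : continuous phi -> Ck 1 f ->
  (forall p, differentiable (Iop phi L f) p) /\
  (forall p v, 'D_v (Iop phi L f) p =
     I01 (fun t => phi t * 'D_(v *m L t) f (p *m L t))).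
Proof.
move=> cphi cf; have [df pf] := cf.
suff H p : differentiable (Iop phi L f) p /\ forall v, 'D_v (Iop phi L f) p =
     I01 (fun t => phi t * 'D_(v *m L t) f (p *m L t)).
  by split=> [p|p v]; [exact: (H p).1|exact: (H p).2].
have [|||dI DI] := @I01_diff _ _ (fun t q => phi t * f (q *m L t)) p.
- move=> t x; apply: (@differentiableZ _ _ _ (fun q => f (q *m L t))).
  exact: differentiable_mulmxr.
- by apply: continuous_Iop_arg => //; exact: Ck_continuous cf.
- move=> j; under [X in continuous X]eq_fun => z.
    rewrite derive_Iop_arg// derive_sum_coord// mulr_sumr.
    under eq_bigr => k _ do rewrite mulrA.
    over.
  move=> z; apply: (@cvg_sum _ _ _ (nbhs z)) => k.
  apply: (@continuous_Iop_arg (fun t => phi t * (delta_mx 0 j *m L t) 0 k)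
    (fun q => 'D_(delta_mx 0 k) f q)); last exact: pf.
  move=> t; apply: cvgM; first exact: cphi.
  under eq_fun do rewrite -rowE mxE.
  by rewrite -rowE mxE; exact: cL.
- split=> // v; rewrite DI; apply: eq_I01 => t _.
  exact: derive_Iop_arg.
Qed.

(** The partial derivative along coordinate [j] is the sum over [i] of such integrals with weight
    [phi t * L t j i], applied to the [i]-th partial of [f]; hence the induction generalizes [phi]
    along with [f]. *)
Lemma Ck_Iop k phi f : continuous phi -> Ck k f -> Ck k (Iop phi L f).
Proof.
elim: k phi f => [|k IH] phi f cphi cf.
  apply: (@I01_continuous _ _ (fun t p => phi t * f (p *m L t))).
  exact: continuous_Iop_arg.
have c1 : Ck 1 f.
  have [df pf] := cf; split=> // j; exact: Ck_continuous (pf j).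
have [dI DI] := Iop_diff cphi c1; split=> // j.
have cphiL i : continuous (fun t => phi t * L t j i).
  by move=> t; apply: cvgM; [exact: cphi|exact: cL].
apply: (@eq_Ck _ _ _ (fun p => \sum_i
    Iop (fun t => phi t * L t j i) L (fun q => 'D_(delta_mx 0 i) f q) p)); last first.
  by apply: Ck_sum => i; apply: IH => //; exact: cf.2.
move=> p; rewrite DI /Iop -I01_sum; last first.
  move=> i; exact: (@continuous_Iop_slice (fun t => phi t * L t j i)
    (fun q => 'D_(delta_mx 0 i) f q) p (cphiL i) (c1.2 i)).
apply: eq_I01 => t _; rewrite derive_sum_coord; last exact: c1.1.
rewrite mulr_sumr; apply: eq_bigr => i _.
by rewrite mulrA -rowE mxE.
Qed.

Lemma smooth_Iop phi f : continuous phi -> smooth f -> smooth (Iop phi L f).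
Proof. by move=> cphi sf k; exact: Ck_Iop. Qed.

Lemma derive_Iop phi f p v : continuous phi -> smooth f ->
  'D_v (Iop phi L f) p = I01 (fun t => phi t * 'D_(v *m L t) f (p *m L t)).
Proof. by move=> cphi sf; rewrite (Iop_diff cphi (sf 1)).2. Qed.

Lemma IopD phi f g p : continuous phi -> continuous f -> continuous g ->
  Iop phi L (fun q => f q + g q) p = Iop phi L f p + Iop phi L g p.
Proof.
move=> cphi cf cg; rewrite /Iop -I01D; [|exact: continuous_Iop_slice..].
by apply: eq_I01 => t _; rewrite mulrDr.
Qed.

Lemma IopZ phi (c : R) f p : continuous phi -> continuous f ->
  Iop phi L (fun q => c * f q) p = c * Iop phi L f p.
Proof.
move=> cphi cf; rewrite /Iop -I01Z; last exact: continuous_Iop_slice.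
by apply: eq_I01 => t _; rewrite mulrCA.
Qed.

End LinearFamily.

(** * Rotations and the vector fields X_i *)

Section Rotations.
Variables (R : realType) (n : nat).
Notation V := (pt R n).
Implicit Types (f g : V -> R) (p v : V) (i j : 'I_n).

(** Quarter turn in the [i]-th plane: [p *m Jmx i] is the vector with [-y_i] in the [x_i] slot and
    [x_i] in the [y_i] slot, half of [X_i] at [p]. Its square is minus the projection [Pmx i] onto
    that plane. *)
Definition Jmx i : 'M[R]_(n + n) :=
  delta_mx (lshift n i) (rshift n i) - delta_mx (rshift n i) (lshift n i).

Definition Pmx i : 'M[R]_(n + n) :=
  delta_mx (lshift n i) (lshift n i) + delta_mx (rshift n i) (rshift n i).

Lemma mul_Jmx_neq i j : i != j -> Jmx i *m Jmx j = 0.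
Proof.
move=> ij; rewrite /Jmx mulmxBl !mulmxBr !mul_delta_mx_cond.
rewrite eq_lrshift eq_rlshift (inj_eq (@lshift_inj _ _)) (inj_eq (@rshift_inj _ _)).
by rewrite (negbTE ij) !mulr0n !subrr.
Qed.

Lemma mul_Jmx i : Jmx i *m Jmx i = - Pmx i.
Proof.
rewrite /Jmx /Pmx mulmxBl !mulmxBr !mul_delta_mx_cond.
by rewrite eq_lrshift eq_rlshift !eqxx !mulr0n !mulr1n sub0r subr0 opprD.
Qed.

Lemma Jmx_comm i j : Jmx i *m Jmx j = Jmx j *m Jmx i.
Proof.
have [->//|ij] := eqVneq i j.
by rewrite !mul_Jmx_neq// eq_sym.
Qed.

Lemma mul_PJmx i : Pmx i *m Jmx i = Jmx i.
Proof.
rewrite /Jmx /Pmx mulmxDl !mulmxBr !mul_delta_mx_cond.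
by rewrite eq_lrshift eq_rlshift !eqxx !mulr0n !mulr1n sub0r subr0.
Qed.

(** The exponential of [t *: Jmx i], in closed form thanks to [Jmx i *m Jmx i = - Pmx i]. *)
Definition rotmx i (t : R) : 'M[R]_(n + n) :=
  1%:M + (cos t - 1) *: Pmx i + sin t *: Jmx i.

Lemma PJmx_comm i j : Pmx i *m Jmx j = Jmx j *m Pmx i.
Proof.
rewrite -[Pmx i]opprK -mul_Jmx mulNmx mulmxN; congr (- _).
by rewrite -mulmxA (Jmx_comm i j) mulmxA (Jmx_comm i j) -mulmxA.
Qed.

Lemma rot_Jmx_comm i j t : rotmx i t *m Jmx j = Jmx j *m rotmx i t.
Proof.
have := PJmx_comm i j; have := Jmx_comm i j; rewrite /rotmx.
move: (Jmx i) (Jmx j) (Pmx i) => A B P AB PB.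
by rewrite !mulmxDl !mulmxDr mul1mx mulmx1 -!scalemxAl -!scalemxAr PB AB.
Qed.

Lemma mulmx_rot (p : V) i t :
  p *m rotmx i t = p + (cos t - 1) *: (p *m Pmx i) + sin t *: (p *m Jmx i).
Proof.
rewrite /rotmx; move: (Jmx i) (Pmx i) => A P.
by rewrite !mulmxDr mulmx1 -!scalemxAr.
Qed.

Lemma rotmx0 i : rotmx i 0 = 1%:M.
Proof. by rewrite /rotmx cos0 sin0 subrr !scale0r !addr0. Qed.

Lemma rotmx_2pi i : rotmx i (pi *+ 2) = 1%:M.
Proof. by rewrite /rotmx cos2pi sin2pi subrr !scale0r !addr0. Qed.

Lemma mulmx_delta (p : V) (a b : 'I_(n + n)) (c : 'I_(n + n)) :
  (p *m delta_mx a b) 0 c = p 0 a * (c == b)%:R.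
Proof.
rewrite mxE (bigD1 a)//= big1 ?addr0 ?mxE ?eqxx// => k ka.
by rewrite mxE (negbTE ka) mulr0.
Qed.

Lemma mulmx_JmxE p i c : (p *m Jmx i) 0 c =
  xc i p * (c == rshift n i)%:R - yc i p * (c == lshift n i)%:R.
Proof.
by rewrite /Jmx mulmxBr [LHS]mxE [X in _ + X]mxE !mulmx_delta.
Qed.

Lemma mulmx_PmxE p i c : (p *m Pmx i) 0 c =
  xc i p * (c == lshift n i)%:R + yc i p * (c == rshift n i)%:R.
Proof. by rewrite /Pmx mulmxDr [LHS]mxE !mulmx_delta. Qed.

Lemma mulmx_rotE p i t c : (p *m rotmx i t) 0 c = p 0 c +
  (cos t - 1) * (xc i p * (c == lshift n i)%:R + yc i p * (c == rshift n i)%:R) +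
  sin t * (xc i p * (c == rshift n i)%:R - yc i p * (c == lshift n i)%:R).
Proof.
rewrite mulmx_rot -mulmx_JmxE -mulmx_PmxE.
rewrite [LHS]mxE [X in X + _ = _]mxE.
by congr (_ + _ + _); rewrite [LHS]mxE.
Qed.

Lemma xc_rot i j p t :
  xc j (p *m rotmx i t) = if j == i then xc i p * cos t - yc i p * sin t else xc j p.
Proof.
rewrite {1}/xc mulmx_rotE -/(xc j p) eq_lrshift (inj_eq (@lshift_inj _ _)).
case: eqP => [->|_]; rewrite ?(mulr1,mulr0,addr0,subr0,sub0r,oppr0)//.
by ring.
Qed.

Lemma yc_rot i j p t :
  yc j (p *m rotmx i t) = if j == i then yc i p * cos t + xc i p * sin t else yc j p.
Proof.
rewrite {1}/yc mulmx_rotE -/(yc j p) eq_rlshift (inj_eq (@rshift_inj _ _)).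
case: eqP => [->|_]; rewrite ?(mulr1,mulr0,addr0,subr0,sub0r,oppr0,add0r)//.
by ring.
Qed.

Lemma hh_rot i j p t : hh j (p *m rotmx i t) = hh j p.
Proof.
rewrite /hh xc_rot yc_rot; case: eqP => [->|//].
have := cos2Dsin2 t; set c := cos t; set s := sin t => cs.
transitivity ((xc i p ^+ 2 + yc i p ^+ 2) * (c ^+ 2 + s ^+ 2)); first by ring.
by rewrite cs mulr1.
Qed.

Lemma hvec_rot i p t : hvec (p *m rotmx i t) = hvec p.
Proof. by apply/rowP => j; rewrite !mxE hh_rot. Qed.

Lemma Xf_derive i f p : differentiable f p -> Xf i f p = 2 * 'D_(p *m Jmx i) f p.
Proof.
move=> df; rewrite /Xf; congr (2 * _).
rewrite /xc /yc !deriveE// -!linearZ -linearD/=; congr ('d f p _).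
apply/rowP => c; rewrite mulmx_JmxE !mxE !eqxx/=.
by rewrite mulNr addrC.
Qed.

Lemma smooth_Xf i f : smooth f -> smooth (Xf i f).
Proof.
move=> sf; rewrite /Xf; apply: smoothZ; apply: smoothD; apply: smoothM.
- under eq_fun do rewrite -mulN1r.
  exact/smoothZ/smooth_coord.
- exact: smooth_partial.
- exact: smooth_coord.
- exact: smooth_partial.
Qed.

Lemma XfD i f g p : smooth f -> smooth g ->
  Xf i (fun q => f q + g q) p = Xf i f p + Xf i g p.
Proof.
move=> sf sg; rewrite /Xf.
have D v : 'D_v (fun q => f q + g q) p = 'D_v f p + 'D_v g p.
  by apply: deriveD; exact: smooth_derivable.
rewrite !D; move: ('D_(ex R i) f p) ('D_(ey R i) f p) => a b.
by move: ('D_(ex R i) g p) ('D_(ey R i) g p) => c d; ring.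
Qed.

Lemma XfZ i (c : R) f p : smooth f -> Xf i (fun q => c * f q) p = c * Xf i f p.
Proof.
move=> sf; rewrite /Xf.
have D v : 'D_v (fun q => c * f q) p = c * 'D_v f p.
  by apply: deriveZ; exact: smooth_derivable.
by rewrite !D; move: ('D_(ex R i) f p) ('D_(ey R i) f p) => a b; ring.
Qed.

Lemma XfB i f g p : smooth f -> smooth g ->
  Xf i (fun q => f q - g q) p = Xf i f p - Xf i g p.
Proof.
move=> sf sg; under [X in Xf i X]eq_fun do rewrite -mulN1r.
by rewrite XfD ?XfZ ?mulN1r//; exact: smoothZ.
Qed.

Lemma Xf0 i p : Xf i (fun=> 0) p = 0.
Proof. by rewrite /Xf !derive_cst !mulr0 addr0 mulr0. Qed.

Lemma Xf_sum i (I : Type) (r : seq I) (P : pred I) (F : I -> V -> R) p :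
  (forall k, smooth (F k)) ->
  Xf i (fun q => \sum_(k <- r | P k) F k q) p = \sum_(k <- r | P k) Xf i (F k) p.
Proof.
move=> sF; elim: r => [|k r IH].
  under [X in Xf i X]eq_fun do rewrite big_nil.
  by rewrite big_nil Xf0.
rewrite big_cons -IH; under [X in Xf i X]eq_fun do rewrite big_cons.
by case: (P k) => //; rewrite XfD//; exact: smooth_sum.
Qed.

Lemma mulmx_comm (p : V) (A B : 'M[R]_(n + n)) :
  A *m B = B *m A -> p *m A *m B = p *m B *m A.
Proof. by rewrite -!mulmxA => ->. Qed.

(** [X_i f] at [q] is twice the derivative along [q *m Jmx i], and the chain rule sends a direction
    [v] to [v *m L t]. As [Jmx i] commutes with [L t], the direction obtained at [p *m L t] is the
    one that [X_i] has there. *)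
Lemma Xf_Iop i f (phi : R -> R) (L : R -> 'M[R]_(n + n)) p :
  (forall a b, continuous (fun t => L t a b)) -> continuous phi -> smooth f ->
  (forall t, Jmx i *m L t = L t *m Jmx i) ->
  Xf i (Iop phi L f) p = Iop phi L (Xf i f) p.
Proof.
move=> cL cphi sf JL.
have sX : smooth (fun q => 2^-1 * Xf i f q) by exact/smoothZ/smooth_Xf.
rewrite (Xf_derive _ (smooth_differentiable p (smooth_Iop cL cphi sf))).
rewrite (derive_Iop cL _ _ cphi sf).
transitivity (2 * Iop phi L (fun q => 2^-1 * Xf i f q) p).
  congr (2 * _); apply: eq_I01 => t _; congr (_ * _).
  rewrite (Xf_derive _ (smooth_differentiable (p *m L t) sf)).
  by rewrite (mulmx_comm p (JL t)) mulKf.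
rewrite -(IopZ _ _ _ cphi (smooth_continuous sX))//.
by apply: eq_I01 => t _; congr (_ * _); rewrite mulVKf.
Qed.

Lemma is_derive_scalel (g : R -> R) (dg : R) (W : normedModType R) (w : W) (t : R) :
  is_derive t 1 g dg -> is_derive t 1 (fun s => g s *: w) (dg *: w).
Proof.
move=> H; have Dg : differentiable g t by apply/derivable1_diffP; exact: ex_derive.
apply: DeriveDef; first by apply: diff_derivable; exact: differentiableZl.
rewrite deriveE; last exact: differentiableZl.
by rewrite (diffZl _ Dg) -deriveE// derive_val.
Qed.

Lemma is_derive_rot i p (w t : R) :
  is_derive t 1 (fun s => p *m rotmx i (w * s)) (w *: (p *m rotmx i (w * t) *m Jmx i)).
Proof.
have dw : is_derive t 1 (fun s : R => w * s) w.
  have H := is_deriveM (is_derive_cst w t 1) (is_derive_id t 1).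
  by apply: (is_derive_eq H); rewrite /GRing.scale/= mulr1 mulr0 addr0.
have dc := is_derive1_comp (is_derive_cos (w * t)) dw.
have ds := is_derive1_comp (is_derive_sin (w * t)) dw.
have d1 := is_deriveD (is_derive_cst (-1 : R) t 1) dc.
have d2 := is_derive_scalel (p *m Pmx i) d1.
have d3 := is_derive_scalel (p *m Jmx i) ds.
have d4 := is_deriveD (is_deriveD (is_derive_cst p t 1) d2) d3.
rewrite (_ : (fun s => _) = cst p +
   (fun s => (cst (-1) + (cos \o (fun s : R => w * s))) s *: (p *m Pmx i)) +
   (fun s => (sin \o (fun s : R => w * s)) s *: (p *m Jmx i))); last first.
  apply/funext => s; rewrite mulmx_rot !fctE /=.
  by rewrite [cos _ - 1]addrC.
apply: (is_derive_eq d4).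
have PJ := mul_PJmx i; have JJ := mul_Jmx i; rewrite mulmx_rot.
move: (Jmx i) (Pmx i) PJ JJ => J P PJ JJ.
rewrite !mulmxDl -!scalemxAl -!(mulmxA p) PJ JJ mulmxN scalerBl scale1r.
rewrite [p *m _ + (_ - _)]addrC subrK.
rewrite !add0r scalerDr scalerN !scalerA scalerN addrC.
by rewrite scalerA mulNr scaleNr (mulrC w (cos _)) (mulrC w (sin _)).
Qed.

(** The curve has angular speed [w] and [X_i] is twice the angular field, whence [w / 2]. *)
Lemma is_derive_comp_rot i f p (w t : R) : smooth f ->
  is_derive t 1 (fun s => f (p *m rotmx i (w * s)))
    (w / 2 * Xf i f (p *m rotmx i (w * t))).
Proof.
move=> sf.
have df : differentiable f (p *m rotmx i (w * t)) by exact: smooth_differentiable.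
have H := is_derive_curve df (is_derive_rot i p w t).
apply: (is_derive_eq H).
by rewrite deriveE// linearZ -deriveE// Xf_derive// [RHS]mulrA mulfVK.
Qed.

Lemma continuous_rot (w : R) i a b : continuous (fun t : R => rotmx i (w * t) a b).
Proof.
rewrite (_ : (fun t => _) = fun s => ((delta_mx 0 a : V) *m rotmx i (w * s)) 0 b).
  move=> t.
  have D : differentiable (fun s : R => (delta_mx 0 a : V) *m rotmx i (w * s)) t.
    by apply/derivable1_diffP; have [] := is_derive_rot i (delta_mx 0 a) w t.
  apply: (@cvg_comp _ _ _ (fun s : R => (delta_mx 0 a : V) *m rotmx i (w * s))
    (fun q : V => q 0 b) (nbhs t) (nbhs ((delta_mx 0 a : V) *m rotmx i (w * t)))).
    exact: (differentiable_continuous D).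
  exact: coord_continuous.
by apply/funext => s; rewrite -rowE [RHS]mxE.
Qed.

Lemma Xf_eq0P i f : smooth f ->
  (forall p, Xf i f p = 0) <-> (forall t p, f (p *m rotmx i t) = f p).
Proof.
move=> sf; split=> [X0 t p|inv p].
  have H (s : R) : is_derive s 1 (fun s => f (p *m rotmx i (1 * s))) 0.
    by apply: (is_derive_eq (is_derive_comp_rot i p 1 s sf)); rewrite X0 mulr0.
  have := is_derive_0_is_cst t 0 H.
  by rewrite mulr0 rotmx0 mulmx1 mul1r.
(* Angular speed 2 is that of the flow of [X_i], so the derivative at 0 is exactly [Xf i f p]. *)
have H := is_derive_comp_rot i p 2 0 sf.
move: H; rewrite divff// mul1r mulr0 rotmx0 mulmx1 => -[_ <-].
by under eq_fun do rewrite inv; exact: derive_cst.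
Qed.

End Rotations.

(** * Averaging over orbits *)

Section Averages.
Variables (R : realType) (n : nat).
Notation V := (pt R n).
Implicit Types (f g : V -> R) (p v : V) (i j : 'I_n) (s : seq 'I_n).

(** Time is rescaled so that [[0, 1]] is one full rotation. The rotation by [2 pi t] is the flow of
    [X_i] at time [pi t], which is the origin of the factors [pi] below. *)
Definition turn i (t : R) : 'M[R]_(n + n) := rotmx i ((pi *+ 2) * t).

Definition avg i : (V -> R) -> V -> R := Iop (fun=> 1) (turn i).

(* A right inverse of X_i on functions of zero average: integrate [(pi t) f]
   by parts along the closed orbit. *)
Definition prim i : (V -> R) -> V -> R := Iop (fun t => pi * t) (turn i).

Let cturn i a b : continuous (fun t => turn i t a b).
Proof. exact: continuous_rot. Qed.

Let cone : continuous (fun _ : R => 1 : R).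
Proof. exact: cst_continuous. Qed.

Let cpi : continuous (fun t : R => pi * t).
Proof. by move=> t; apply: cvgM; [exact: cvg_cst|exact: cvg_id]. Qed.

Lemma smooth_avg i f : smooth f -> smooth (avg i f).
Proof. by move=> sf; exact: smooth_Iop. Qed.

Lemma smooth_prim i f : smooth f -> smooth (prim i f).
Proof. by move=> sf; exact: smooth_Iop. Qed.

Lemma Xf_avg i j f : smooth f -> Xf j (avg i f) = avg i (Xf j f).
Proof.
move=> sf; apply/funext => p; apply: Xf_Iop => //.
by move=> t; rewrite rot_Jmx_comm.
Qed.

Lemma Xf_prim i j f : smooth f -> Xf j (prim i f) = prim i (Xf j f).
Proof.
move=> sf; apply/funext => p; apply: Xf_Iop => //.
by move=> t; rewrite rot_Jmx_comm.
Qed.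

Lemma avg_linear i (a b : R) f g : smooth f -> smooth g ->
  avg i (fun q => a * f q + b * g q) = (fun p => a * avg i f p + b * avg i g p).
Proof.
move=> sf sg; apply/funext => p.
rewrite /avg (IopD (@cturn i))//; try exact/smooth_continuous/smoothZ.
by rewrite !(IopZ (@cturn i))//; exact: smooth_continuous.
Qed.

Lemma prim_linear i (a b : R) f g : smooth f -> smooth g ->
  prim i (fun q => a * f q + b * g q) = (fun p => a * prim i f p + b * prim i g p).
Proof.
move=> sf sg; apply/funext => p.
rewrite /prim (IopD (@cturn i))//; try exact/smooth_continuous/smoothZ.
by rewrite !(IopZ (@cturn i))//; exact: smooth_continuous.
Qed.

Lemma avg_invariant i f : (forall t p, f (p *m rotmx i t) = f p) -> avg i f = f.
Proof.
move=> inv; apply/funext => p; rewrite /avg /Iop -[RHS]I01_cst.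
by apply: eq_I01 => t _; rewrite mul1r inv.
Qed.

Lemma avg0 i : avg i (fun=> 0) = (fun=> 0).
Proof. exact: avg_invariant. Qed.

Lemma turn0 i : turn i 0 = 1%:M.
Proof. by rewrite /turn mulr0 rotmx0. Qed.

Lemma turn1 i : turn i 1 = 1%:M.
Proof. by rewrite /turn mulr1 rotmx_2pi. Qed.

Let half : (pi *+ 2) / 2 = pi :> R.
Proof. by rewrite -(mulr_natr pi 2) mulfK. Qed.

Lemma is_derive_turn i f p (t : R) : smooth f ->
  is_derive t 1 (fun s : R => f (p *m turn i s)) (pi * Xf i f (p *m turn i t)).
Proof.
move=> sf; apply: (is_derive_eq (is_derive_comp_rot i p (pi *+ 2) t sf)).
by rewrite half.
Qed.

Lemma avg_Xf i f : smooth f -> avg i (Xf i f) = (fun=> 0).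
Proof.
move=> sf; apply/funext => p.
have sX := smooth_continuous (smooth_Xf i sf).
apply: (@mulfI _ pi); first by rewrite gt_eqF// pi_gt0.
rewrite mulr0 /avg -(IopZ (@cturn i))// /Iop.
rewrite (_ : (fun t => _) = fun t => pi * Xf i f (p *m turn i t)); last first.
  by apply/funext => t; rewrite mul1r.
have cX : continuous (fun t => pi * Xf i f (p *m turn i t)).
  exact: (@continuous_Iop_slice _ _ _ (@cturn i) (fun=> pi) _ p
    (@cst_continuous _ _ _)).
rewrite (I01_FTC2 cX (fun t => is_derive_turn i p t sf)).
by rewrite turn0 turn1 subrr.
Qed.

(** The product rule for [s * f (p *m turn i s)] yields the two integrands; the boundary term is
    [f p] because the orbit closes at time 1. *)
Lemma prim_Xf i f : smooth f -> prim i (Xf i f) = (fun p => f p - avg i f p).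
Proof.
move=> sf; apply/funext => p.
have cf := smooth_continuous sf.
have cX := smooth_continuous (smooth_Xf i sf).
apply/eqP; rewrite eq_sym subr_eq addrC eq_sym -subr_eq0; apply/eqP.
have c1 := continuous_Iop_slice (@cturn i) (p := p) cone cf.
have c2 := continuous_Iop_slice (@cturn i) (p := p) cpi cX.
rewrite /prim /avg /Iop -I01D//.
have c12 : continuous (fun t => 1 * f (p *m turn i t) +
    pi * t * Xf i f (p *m turn i t)).
  by move=> t; apply: cvgD; [exact: c1|exact: c2].
have D (t : R) : is_derive t 1 (fun s : R => s * f (p *m turn i s))
    (1 * f (p *m turn i t) + pi * t * Xf i f (p *m turn i t)).
  have H := is_deriveM (is_derive_id t 1) (is_derive_turn i p t sf).
  apply: (is_derive_eq H); rewrite /GRing.scale/= mul1r mulr1 addrC.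
  by congr (_ + _); rewrite mulrCA mulrA.
by rewrite (I01_FTC2 c12 D) turn1 mulmx1 mul1r mul0r subr0 subrr.
Qed.

(* Instead of the symmetry of second derivatives: apply [X_i X_j] to
   [f = avg i f + prim i (X_i f)] and compare with the same formula for [X_j f]. *)
Lemma Xf_comm i j f : smooth f -> Xf i (Xf j f) = Xf j (Xf i f).
Proof.
move=> sf; have sXi := smooth_Xf i sf; have sXj := smooth_Xf j sf.
have sg1 := smooth_Xf j sXi; have sg2 := smooth_Xf i sXj.
have E0 : Xf j (fun q => f q - avg i f q) =
          (fun q => Xf j f q - avg i (Xf j f) q).
  rewrite -(Xf_avg i j sf).
  by apply/funext => q; exact: (XfB j q sf (smooth_avg i sf)).
have E : prim i (Xf j (Xf i f)) = prim i (Xf i (Xf j f)).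
  apply: etrans (esym (Xf_prim i j sXi)) _.
  apply: etrans (esym (prim_Xf i sXj)).
  by apply: etrans E0; exact: (congr1 (Xf j) (prim_Xf i sf)).
have A1 : avg i (Xf j (Xf i f)) = fun=> 0.
  apply: etrans (esym (Xf_avg i j sXi)) _.
  apply: etrans (congr1 (Xf j) (avg_Xf i sf)) _.
  by apply/funext => q; exact: Xf0.
have sub0 (u w : V -> R) : w = (fun=> 0) -> (fun q => u q - w q) = u.
  by move=> ->; apply/funext => q; rewrite subr0.
have B1 := etrans (etrans (Xf_prim i i sg1) (prim_Xf i sg1)) (sub0 _ _ A1).
have B2 := etrans (etrans (Xf_prim i i sg2) (prim_Xf i sg2))
  (sub0 _ _ (avg_Xf i sXj)).
exact: etrans (etrans (esym B2) (congr1 (Xf i) (esym E))) B1.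
Qed.

Definition avgs s f : V -> R := foldr avg f s.

Lemma smooth_avgs s f : smooth f -> smooth (avgs s f).
Proof. by move=> sf; elim: s => //= i s; exact: smooth_avg. Qed.

Lemma avgs_linear s (a b : R) f g : smooth f -> smooth g ->
  avgs s (fun q => a * f q + b * g q) = (fun p => a * avgs s f p + b * avgs s g p).
Proof.
move=> sf sg; elim: s => //= i s ->.
by rewrite avg_linear//; exact: smooth_avgs.
Qed.

Lemma Xf_avgs s j f : smooth f -> Xf j (avgs s f) = avgs s (Xf j f).
Proof.
move=> sf; elim: s => //= i s IH.
by rewrite Xf_avg ?IH//; exact: smooth_avgs.
Qed.

Lemma Xf_avgs_eq0 s j f : smooth f -> j \in s -> Xf j (avgs s f) = fun=> 0.
Proof.
move=> sf; elim: s => //= i s IH; have ss := smooth_avgs s sf.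
rewrite inE Xf_avg// => /predU1P[->|js]; first by rewrite avg_Xf.
by rewrite IH// avg0.
Qed.

Lemma avgs_invariant s f : (forall i t p, f (p *m rotmx i t) = f p) -> avgs s f = f.
Proof. by move=> inv; elim: s => //= i s ->; exact: avg_invariant. Qed.

End Averages.

(** * Invariant functions, and vanishing by density *)

Section FunctionsOfH.
Variables (R : realType) (n : nat).
Notation V := (pt R n).
Implicit Types (f g u : V -> R) (p q v : V) (i j : 'I_n).

Lemma hh_ge0 i p : 0 <= hh i p.
Proof. by rewrite addr_ge0 ?sqr_ge0. Qed.

Lemma rot_to_axis i p : exists t,
  xc i (p *m rotmx i t) = Num.sqrt (hh i p) /\ yc i (p *m rotmx i t) = 0.
Proof.
suff [t [h1 h2]] : exists t, xc i p * cos t - yc i p * sin t = Num.sqrt (hh i p) /\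
    yc i p * cos t + xc i p * sin t = 0.
  by exists t; rewrite xc_rot yc_rot eqxx.
have := sqr_sqrtr (hh_ge0 i p); have := sqrtr_ge0 (hh i p); rewrite /hh.
move: (xc i p) (yc i p) => x y; set r := Num.sqrt _ => r_ge0 rE.
have [r0|rN0] := eqVneq r 0.
  move/eqP: rE; rewrite r0 expr0n/= eq_sym paddr_eq0 ?sqr_ge0// !sqrf_eq0.
  by move=> /andP[/eqP -> /eqP ->]; exists 0; rewrite !mul0r subrr addr0.
have r_gt0 : 0 < r by rewrite lt_def rN0.
have cE : (x / r) ^+ 2 + (y / r) ^+ 2 = 1.
  by rewrite !expr_div_n -mulrDl -rE divff// expf_neq0.
have x1 : -1 <= x / r <= 1.
  rewrite -ler_norml -(@expr_le1 _ 2)// real_normK ?num_real//.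
  by rewrite -cE lerDl sqr_ge0.
have cosE : cos (acos (x / r)) = x / r by rewrite acosK.
have sinE : sin (acos (x / r)) = `|y / r|.
  rewrite sin_acos// -sqrtr_sqr; congr Num.sqrt.
  by rewrite -cE addrAC subrr add0r.
(* The angle [acos (x / r)] has nonnegative sine; it is negated when [0 <= y / r] so that the sine
   is [- (y / r)]. *)
have key : exists t, cos t = x / r /\ sin t = - (y / r).
  have [y0|y0] := leP 0 (y / r).
    by exists (- acos (x / r)); rewrite cosN sinN cosE sinE ger0_norm.
  by exists (acos (x / r)); rewrite cosE sinE ltr0_norm.
have [t [ct st]] := key; exists t; rewrite ct st; split; last by field.
apply: (mulIf rN0); rewrite -[RHS]expr2 rE; field.
exact: rN0.
Qed.

(** Every orbit of the rotations meets the section [x_i = sqrt h_i], [y_i = 0] at a point determined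
    by [hvec], so [f] can be [g] read off on that section. *)
Lemma invariant_function_of_h g : (forall i t p, g (p *m rotmx i t) = g p) ->
  exists f : 'rV[R]_n -> R, forall p, g p = f (hvec p).
Proof.
move=> inv.
exists (fun w => g (row_mx (\row_i Num.sqrt (w 0 i)) 0)) => p.
(* The planes are rotated one at a time; a rotation in plane [i] does not disturb the coordinates
   already adjusted in the other planes. *)
have H (s : seq 'I_n) : exists q, [/\ g q = g p, hvec q = hvec p &
    forall i, i \in s -> xc i q = Num.sqrt (hh i p) /\ yc i q = 0].
  elim: s => [|i s [q [gq hq IH]]]; first by exists p.
  have [t [xt yt]] := rot_to_axis i q.
  have hqE j : hh j q = hh j p by have /rowP/(_ j) := hq; rewrite !mxE.
  exists (q *m rotmx i t); split; rewrite ?inv ?hvec_rot// => j.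
  rewrite inE; have [-> _|ji /= js] := eqVneq j i; first by rewrite xt yt hqE.
  by rewrite xc_rot yc_rot (negbTE ji); exact: IH.
have [q [<- hq qE]] := H (enum 'I_n).
congr g; apply/rowP => c; rewrite mxE; case: splitP => i ci.
  have -> : c = lshift n i by exact: val_inj.
  by rewrite !mxE -/(xc i q) (qE i _).1 ?mem_enum.
have -> : c = rshift n i by exact: val_inj.
by rewrite mxE -/(yc i q) (qE i _).2 ?mem_enum.
Qed.

(** Identities first obtained where some coordinate is nonzero are carried to its zero set by this
    limit along a line. *)
Lemma continuous_line_eq0 u p v : continuous u ->
  (forall s : R, s != 0 -> u (p + s *: v) = 0) -> u p = 0.
Proof.
move=> cu u0; have dl : {for (0 : R), continuous (fun s : R => p + s *: v)}.
  apply: continuousD; first exact: cst_continuous.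
  exact: scalel_continuous.
have c0 : u (p + s *: v) @[s --> (0 : R)] --> u p.
  have {2}-> : p = p + 0 *: v by rewrite scale0r addr0.
  exact: (@continuous_comp _ _ _ (fun s : R => p + s *: v) u _ dl (cu _)).
have c1 : u (p + s *: v) @[s --> (0 : R)^'] --> u p
  by apply: cvg_trans c0; apply: cvg_app; exact: cvg_within.
have c2 : u (p + s *: v) @[s --> (0 : R)^'] --> (0 : R).
  apply: cvg_near_cst; near=> s; apply: u0.
  by near: s; exact: nbhs_dnbhs_neq.
have hR := @norm_hausdorff _ R.
exact: etrans (esym (cvg_lim hR c1)) (cvg_lim hR c2).
Unshelve. all: by end_near. Qed.

Lemma xc_line i p s : xc i (p + s *: ex R i) = xc i p + s.
Proof. by rewrite /xc !mxE !eqxx mulr1. Qed.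

(** On this line [h_i] vanishes for at most one [s]. The hypothesis is confined to the line so that
    the lemma also applies within [Sigma_j] for [j != i]: the line through a point of [Sigma_j]
    stays there. *)
Lemma hh_mul_eq0 i u p : continuous u ->
  (forall s, hh i (p + s *: ex R i) * u (p + s *: ex R i) = 0) -> u p = 0.
Proof.
move=> cu hu.
have hN0 s : xc i p + s != 0 -> u (p + s *: ex R i) = 0.
  move=> xs; have /eqP := hu s; rewrite mulf_eq0 => /orP[|/eqP//].
  by rewrite /hh xc_line paddr_eq0 ?sqr_ge0// sqrf_eq0 (negbTE xs).
have [x0|x0] := eqVneq (xc i p) 0.
  apply: (continuous_line_eq0 (v := ex R i) cu) => s s0.
  by apply: hN0; rewrite x0 add0r.
by have := hN0 0; rewrite scale0r !addr0; exact.
Qed.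

End FunctionsOfH.

(** * Division by h_j *)

Section Contractions.
Variables (R : realType) (m : nat).
Notation V := 'rV[R]_m.
Implicit Types (f : V -> R) (p v : V) (N : 'M[R]_m).

(** For a projection [N] this scales the range of [N] by [s] and fixes its kernel: it goes from the
    projection [1 - N] at [s = 0] to the identity at [s = 1]. *)
Definition contract N (s : R) : 'M[R]_m := 1%:M + (s - 1) *: N.

Lemma mulmx_contract p N s : p *m contract N s = p + (s - 1) *: (p *m N).
Proof. by rewrite mulmxDr mulmx1 -scalemxAr. Qed.

Lemma continuous_contract N a b : continuous (fun s => contract N s a b).
Proof.
rewrite (_ : (fun s => _) = fun s => (1%:M : 'M[R]_m) a b + (s - 1) * N a b).
  move=> s; apply: cvgD; first exact: cvg_cst.
  apply: cvgM; last exact: cvg_cst.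
  by apply: cvgB; [exact: cvg_id|exact: cvg_cst].
by apply/funext => s; rewrite /contract !mxE.
Qed.

Lemma is_derive_contract p N (s : R) :
  is_derive s 1 (fun t => p *m contract N t) (p *m N).
Proof.
have d1 := is_deriveD (is_derive_id s 1) (is_derive_cst (-1 : R) s 1).
have d2 := is_derive_scalel (p *m N) d1.
have d3 := is_deriveD (is_derive_cst p s 1) d2.
rewrite (_ : (fun t => _) = cst p + (fun t => (id + cst (-1)) t *: (p *m N))).
  by apply: (is_derive_eq d3); rewrite addr0 add0r scale1r.
by apply/funext => t; rewrite mulmx_contract.
Qed.

Lemma smooth_derive f v : smooth f -> smooth (fun p => 'D_v f p).
Proof.
move=> sf; rewrite (_ : (fun p => _) =
    fun p => \sum_j v 0 j * 'D_(delta_mx 0 j) f p).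
  by apply: smooth_sum => j; apply: smoothZ; exact: smooth_partial.
by apply/funext => p; rewrite derive_sum_coord//; exact: smooth_differentiable.
Qed.

(** Hadamard's lemma before a factor is extracted: the fundamental theorem of calculus along the
    contraction, whose velocity [p *m N] does not depend on [s]. *)
Lemma contract_FTC f N p : smooth f ->
  f p - f (p *m contract N 0) = I01 (fun s => 'D_(p *m N) f (p *m contract N s)).
Proof.
move=> sf.
have D (s : R) : is_derive s 1 (fun t => f (p *m contract N t))
    ('D_(p *m N) f (p *m contract N s)).
  exact: (is_derive_curve (smooth_differentiable _ sf) (is_derive_contract p N s)).
have c : continuous (fun s => 'D_(p *m N) f (p *m contract N s)).
  have sD := smooth_continuous (smooth_derive (p *m N) sf).
  have := continuous_Iop_slice (continuous_contract (N := N)) (p := p)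
    (@cst_continuous _ _ (1 : R)) sD.
  by under eq_fun do rewrite mul1r.
by rewrite (I01_FTC2 c D) [in RHS]mulmx_contract subrr scale0r addr0.
Qed.

End Contractions.

Section Division.
Variables (R : realType) (n : nat).
Notation V := (pt R n).
Implicit Types (f g a b u : V -> R) (p v : V) (i j : 'I_n).

Definition Exmx j : 'M[R]_(n + n) := delta_mx (lshift n j) (lshift n j).

Lemma mulmx_Exmx p j : p *m Exmx j = xc j p *: ex R j.
Proof.
by apply/rowP => c; rewrite /Exmx mulmx_delta !mxE eqxx.
Qed.

Lemma mulmx_Pmx p j : p *m Pmx R j = xc j p *: ex R j + yc j p *: ey R j.
Proof. by apply/rowP => c; rewrite mulmx_PmxE !mxE eqxx. Qed.

Lemma deriveDZ f p v w (c d : R) : differentiable f p ->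
  'D_(c *: v + d *: w) f p = c * 'D_v f p + d * 'D_w f p.
Proof. by move=> df; rewrite !deriveE// linearD !linearZ. Qed.

Lemma xc_contractE p j s : xc j (p *m contract (Exmx j) s) = s * xc j p.
Proof.
by rewrite mulmx_contract mulmx_Exmx /xc !mxE !eqxx/= -/(xc j p) mulr1; ring.
Qed.

Lemma xc_contractP p j s : xc j (p *m contract (Pmx R j) s) = s * xc j p.
Proof.
rewrite mulmx_contract mulmx_Pmx /xc !mxE !eqxx/= eq_lrshift.
by rewrite -/(xc j p) mulr1 mulr0 addr0; ring.
Qed.

Lemma yc_contractP p j s : yc j (p *m contract (Pmx R j) s) = s * yc j p.
Proof.
rewrite mulmx_contract mulmx_Pmx /yc !mxE !eqxx/= eq_rlshift.
by rewrite -/(yc j p) mulr1 mulr0 add0r; ring.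
Qed.

(** Hadamard's lemma: contracting [x_j] to 0 has velocity [xc j p *: ex R j], and the factor
    [xc j p] leaves the integral. *)
Lemma divide_by_x j a : smooth a -> (forall p, xc j p = 0 -> a p = 0) ->
  exists2 m, smooth m & forall p, a p = xc j p * m p.
Proof.
move=> sa a0; have sD := smooth_derive (ex R j) sa.
have c1 := @cst_continuous R R (1 : R).
exists (Iop (fun=> 1) (contract (Exmx j)) (fun q => 'D_(ex R j) a q)).
  by apply: smooth_Iop => //; exact: continuous_contract.
move=> p; have cD := smooth_continuous sD.
rewrite -(IopZ (continuous_contract (N := Exmx j)) _ _ c1 cD).
have := contract_FTC (Exmx j) p sa.
rewrite (a0 (p *m _)) ?xc_contractE ?mul0r// subr0 => ->.
apply: eq_I01 => s _; rewrite mul1r mulmx_Exmx.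
have df := smooth_differentiable (p *m contract (Exmx j) s) sa.
by rewrite deriveE// linearZ/= -deriveE.
Qed.

Lemma xc_liney p j s : xc j (p + s *: ey R j) = xc j p.
Proof. by rewrite /xc !mxE eq_lrshift mulr0 addr0. Qed.

Lemma yc_liney p j s : yc j (p + s *: ey R j) = yc j p + s.
Proof. by rewrite /yc !mxE !eqxx mulr1. Qed.

(* Invariance makes the gradient in the j-th plane radial: it is [m] times
   [(x_j, y_j)] with [m] smooth; integrating along rays divides g by h_j. *)
Lemma divide_by_hh j g : smooth g -> (forall p, Xf j g p = 0) ->
  (forall p, Sigma j p -> g p = 0) ->
  exists2 q, smooth q & forall p, g p = hh j p * q p.
Proof.
move=> sg Xg g0.
pose a p := 'D_(ex R j) g p; pose b p := 'D_(ey R j) g p.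
have sa : smooth a by exact: smooth_derive.
have sb : smooth b by exact: smooth_derive.
have ab p : yc j p * a p = xc j p * b p.
  have := Xg p; rewrite /Xf -/(a p) -/(b p).
  by move: (a p) (b p) (xc j p) (yc j p) => A B x y; lra.
have a0 p : xc j p = 0 -> a p = 0.
  move=> x0; have ca := smooth_continuous sa.
  have H q : xc j q = 0 -> yc j q != 0 -> a q = 0.
    by move=> xq /mulfI; apply; rewrite ab xq mul0r mulr0.
  have [y0|y0] := eqVneq (yc j p) 0; last exact: H.
  apply: (continuous_line_eq0 (v := ey R j) ca) => s s0.
  by apply: H; rewrite ?xc_liney ?yc_liney// y0 add0r.
have [m sm am] := divide_by_x sa a0.
have bm p : b p = yc j p * m p.
  have su : smooth (fun p => b p - yc j p * m p).
    by apply: smoothB => //; apply: smoothM => //; exact: smooth_coord.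
  apply/eqP; rewrite -subr_eq0; apply/eqP.
  have H q : xc j q != 0 -> b q - yc j q * m q = 0.
    move=> xq; apply: (mulfI xq); rewrite mulr0 mulrBr -ab am.
    by rewrite mulrCA subrr.
  have [x0|x0] := eqVneq (xc j p) 0; last exact: H.
  apply: (continuous_line_eq0 (v := ex R j) (smooth_continuous su)) => s s0.
  by apply: H; rewrite xc_line x0 add0r.
have cid : continuous (fun s : R => s) by move=> s; exact: cvg_id.
(* At the contracted point the gradient in the plane is [m] times [(s x_j, s y_j)]; paired with the
   velocity [(x_j, y_j)] it gives [s * m * h_j], hence the weight [s]. *)
exists (Iop (fun s => s) (contract (Pmx R j)) m).
  by apply: smooth_Iop => //; exact: continuous_contract.
move=> p; have cm := smooth_continuous sm.
rewrite -(IopZ (continuous_contract (N := Pmx R j)) _ _ cid cm).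
have := contract_FTC (Pmx R j) p sg.
rewrite (g0 (p *m _)) ?subr0; last first.
  by split; rewrite ?xc_contractP ?yc_contractP mul0r.
move=> ->; apply: eq_I01 => s _.
have df := smooth_differentiable (p *m contract (Pmx R j) s) sg.
rewrite mulmx_Pmx (deriveDZ _ _ _ _ df) -/(a _) -/(b _) am bm.
rewrite xc_contractP yc_contractP /hh.
move: (m _) => M; ring.
Qed.

Lemma hh_mul_eq0_all i u : continuous u -> (forall p, hh i p * u p = 0) ->
  forall p, u p = 0.
Proof. by move=> cu hu p; apply: (hh_mul_eq0 (i := i) cu). Qed.

Lemma smooth_hh i : smooth (@hh R n i).
Proof.
rewrite /hh; under eq_fun do rewrite !expr2.
by apply: smoothD; apply: smoothM; exact: smooth_coord.
Qed.

(** One [h_j] is divided out at a time, so each quotient must again be invariant and vanish on the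
    remaining [Sigma_i]. *)
Lemma divide_by_prod_hh (s : seq 'I_n) g : uniq s -> smooth g ->
  (forall i p, Xf i g p = 0) -> (forall i p, i \in s -> Sigma i p -> g p = 0) ->
  exists q, [/\ smooth q, forall i p, Xf i q p = 0 &
    forall p, g p = (\prod_(i <- s) hh i p) * q p].
Proof.
elim: s g => [|j s IH] g; first by exists g; split=> // p; rewrite big_nil mul1r.
move=> /= /andP[js us] sg Xg g0.
have [q sq gq] := divide_by_hh sg (Xg j) (fun p => g0 j p (mem_head _ _)).
have cq := smooth_continuous sq.
(* As [i != j], the line along [ex R j] through a point of [Sigma_i] stays in [Sigma_i], where [g]
   vanishes. *)
have q0 i p : i \in s -> Sigma i p -> q p = 0.
  move=> is_ Sp; apply: (hh_mul_eq0 (i := j) cq) => t; rewrite -gq.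
  apply: (g0 i); first by rewrite inE is_ orbT.
  have ij : i != j by apply: contraNneq js => <-.
  case: Sp => xi yi; split.
    by rewrite -xi /xc !mxE eqxx (inj_eq (@lshift_inj _ _)) (negbTE ij) mulr0 addr0.
  by rewrite -yi /yc !mxE eq_rlshift mulr0 addr0.
(* Since [g] and [h_j] are invariant, [h_j] times the variation of [q] under a rotation is zero, and
   density removes [h_j]. *)
have Xq i p : Xf i q p = 0.
  apply: (Xf_eq0P i sq).2 => t r.
  have suq : continuous (fun p => q (p *m rotmx i t) - q p).
    move=> z; apply: (@cvgB _ _ _ (nbhs z)); last exact: cq.
    apply: (@cvg_comp _ _ _ (fun p : V => p *m rotmx i t) q (nbhs z)
      (nbhs (z *m rotmx i t))); last exact: cq.
    exact: continuous_mulmxr.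
  apply/eqP; rewrite -subr_eq0; apply/eqP.
  apply: (hh_mul_eq0_all (i := j) suq) => z.
  by rewrite mulrBr -gq -(hh_rot i j z t) -gq ((Xf_eq0P i sg).1 (Xg i)) subrr.
have [q' [sq' Xq' qq']] := IH q us sq Xq q0.
exists q'; split=> // p; rewrite big_cons gq qq'.
by rewrite mulrA.
Qed.

Lemma prod_hh_mul_eq0 (s : seq 'I_n) u : continuous u ->
  (forall p, (\prod_(i <- s) hh i p) * u p = 0) -> forall p, u p = 0.
Proof.
elim: s u => [|j s IH] u cu hu p; first by have := hu p; rewrite big_nil mul1r.
have cU := smooth_continuous (smooth_hh j).
apply: (IH u cu) => {}p.
apply: (@hh_mul_eq0_all j (fun p => (\prod_(i <- s) hh i p) * u p)).
  move=> z; apply: (@cvgM _ _ (nbhs z)); last exact: cu.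
  by apply: smooth_continuous; apply: smooth_prod => i; exact: smooth_hh.
by move=> z; have := hu z; rewrite big_cons mulrA.
Qed.

End Division.

Local Close Scope classical_set_scope.

(** * The foliated complex *)

Section Cochains.
Variables (R : realType) (n : nat).
Notation V := (pt R n).
Implicit Types (f g : V -> R) (p : V) (i j l : 'I_n) (J : {set 'I_n}).
Implicit Types (a b c w : cochain R n) (k : nat).

(** The sign of moving slot [j] to the front. It makes sense whether or not [j] lies in [J], and so
    serves both [dF], which removes [j], and [ctr], which inserts it. *)
Definition sgn j J : R := (-1) ^+ #|[set i in J | (val i < val j)%N]|.

Lemma sgnU i j J : i \notin J ->
  sgn j (i |: J) = (-1) ^+ (val i < val j)%N * sgn j J.
Proof.
move=> iJ; rewrite /sgn -exprD; congr (_ ^+ _).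
have -> : [set l in i |: J | (val l < val j)%N] =
    (if (val i < val j)%N then [set i] else finset.set0) :|:
    [set l in J | (val l < val j)%N].
  apply/finset.setP => l; rewrite !inE; case: ifPn => ij; rewrite !inE.
    by case: eqP => [->|]//=; rewrite ij.
  by case: eqP => [->|]//=; rewrite (negbTE ij) andbF.
case: ifPn => ij; last by rewrite finset.set0U.
by rewrite cardsU1 inE (negbTE iJ).
Qed.

Lemma sgnD1 i j J : i \in J -> sgn j J = (-1) ^+ (val i < val j)%N * sgn j (J :\ i).
Proof. by move=> iJ; rewrite -[in LHS](finset.setD1K iJ) sgnU// !inE eqxx. Qed.

Lemma sgn_sqr j J : sgn j J * sgn j J = 1.
Proof. by rewrite /sgn -expr2 sqrr_sign. Qed.

Lemma sign_ltn_neq i j : i != j ->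
  (-1) ^+ (val i < val j)%N = - (-1) ^+ (val j < val i)%N :> R.
Proof.
move=> ij; rewrite -signrN; congr (_ ^+ (nat_of_bool _)).
by rewrite -leqNgt [RHS]leq_eqVlt val_eqE (negbTE ij).
Qed.

Definition smoothc a := forall J, smooth (a J).

Lemma is_form_smooth k a : is_form k a -> smoothc a.
Proof.
move=> fa J; have [kJ|kJ] := eqVneq #|J| k; first exact: (fa J).1.
by rewrite (fa J).2; [exact: smooth_cst|exact/eqP].
Qed.

Lemma smoothc_dF a : smoothc a -> smoothc (dF a).
Proof.
move=> sa J; apply: smooth_sum => j; apply: smoothZ.
exact/smooth_Xf/sa.
Qed.

Lemma dF_add a b : smoothc a -> smoothc b ->
  dF (fun J p => a J p + b J p) = (fun J p => dF a J p + dF b J p).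
Proof.
move=> sa sb; apply/funext => J; apply/funext => p; rewrite /dF -big_split/=.
by apply: eq_bigr => j _; rewrite (XfD j p (sa _) (sb _)) mulrDr.
Qed.

Lemma dF_Xf0 w J p : (forall i K, Xf i (w K) = fun=> 0) -> dF w J p = 0.
Proof. by move=> X0; rewrite /dF big1// => j _; rewrite X0 mulr0. Qed.

(** Exchanging the removed indices [j] and [l] flips the sign and, by [Xf_comm], preserves the
    iterated derivative, so the terms cancel in pairs. *)
Lemma dF_dF a J p : smoothc a -> dF (dF a) J p = 0.
Proof.
move=> sa.
pose S j l := sgn j J * sgn l (J :\ j).
pose D j l := Xf j (Xf l (a (J :\ j :\ l))) p.
have DC j l : D j l = D l j.
  apply: etrans (congr1 (fun h => h p) (Xf_comm j l (sa _))) _.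
  apply: (congr1 (fun K => Xf l (Xf j (a K)) p)).
  by rewrite !finset.setDDl finset.setUC.
have SN j l : j \in J -> l \in J -> l != j -> S j l = - S l j.
  move=> jJ lJ lj; rewrite /S (sgnD1 j lJ) (sgnD1 l jJ) (sign_ltn_neq lj).
  by rewrite -mulrA mulNr mulrCA mulrC -mulrA.
(* The sum is extended by zero to all pairs so that the two indices can be exchanged freely. *)
have -> : dF (dF a) J p =
    \sum_j \sum_l if [&& j \in J, l \in J & l != j] then S j l * D j l else 0.
  rewrite /dF big_mkcond/=; apply: eq_bigr => j _.
  case: (boolP (j \in J)) => jJ; last by rewrite big1.
  rewrite Xf_sum; last by move=> l; exact/smoothZ/smooth_Xf.
  rewrite mulr_sumr big_mkcond/=; apply: eq_bigr => l _; rewrite !inE andbC.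
  case: (_ && _) => //.
  by rewrite (XfZ _ _ _ (smooth_Xf l (sa _))) mulrA.
move: S D DC SN => S D DC SN.
set G := fun j l => if [&& j \in J, l \in J & l != j] then S j l * D j l else 0.
rewrite -[LHS]/(\sum_j \sum_l G j l).
have GN j l : G j l = - G l j.
  rewrite /G DC (eq_sym j l) andbCA.
  case: ifPn => [/and3P[lJ jJ lj]|]; last by rewrite oppr0.
  by rewrite SN// mulNr.
have E : \sum_j \sum_l G j l = - \sum_j \sum_l G j l.
  rewrite [LHS]exchange_big/= -sumrN; apply: eq_bigr => j _.
  by rewrite -sumrN; apply: eq_bigr => l _; exact: GN.
by move: E; move: (\sum_j \sum_l G j l) => x; lra.
Qed.

(** The contraction by [X_i] in components: the sign puts [i] at its place in the increasing order
    of [i |: J], and the value is 0 for [i] in [J] because forms alternate. *)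
Definition ctr i a : cochain R n :=
  fun J p => if i \in J then 0 else sgn i J * a (i |: J) p.

Lemma smoothc_ctr i a : smoothc a -> smoothc (ctr i a).
Proof.
move=> sa J; rewrite /ctr; case: (i \in J); first exact: smooth_cst.
exact: smoothZ.
Qed.

Lemma is_form_ctr i k a : is_form k.+1 a -> is_form k (ctr i a).
Proof.
move=> fa J; split=> [_|kJ].
  exact: (smoothc_ctr i (is_form_smooth fa)).
apply/funext => p; rewrite /ctr; case: ifPn => // iJ.
by rewrite (fa _).2 ?mulr0// cardsU1 iJ add1n => -[].
Qed.

(** If [i] is in [J], only the term [j = i] of [dF (ctr i a)] survives. Otherwise the term [j = i]
    of [dF a] gives [X_i], and the terms with [j] in [J] cancel between the two summands, their
    signs being opposite. *)
Lemma cartan i a J p : smoothc a ->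
  dF (ctr i a) J p + ctr i (dF a) J p = Xf i (a J) p.
Proof.
move=> sa; pose D j K := Xf j (a K) p.
have XC j K : Xf j (ctr i a K) p =
    if i \in K then 0 else sgn i K * D j (i |: K).
  rewrite /ctr; case: (i \in K); first exact: Xf0.
  exact: XfZ.
have -> : dF (ctr i a) J p = \sum_(j in J) sgn j J *
    (if i \in J :\ j then 0 else sgn i (J :\ j) * D j (i |: J :\ j)).
  by apply: eq_bigr => j _; rewrite -XC.
rewrite -[X in _ + X]/(if i \in J then 0 else
  sgn i J * \sum_(j in i |: J) sgn j (i |: J) * D j ((i |: J) :\ j)).
(* From here [D] is arbitrary: what remains is an identity between signs. *)
rewrite -[RHS]/(D i J); move: D {XC} => D.
case: ifPn => iJ.
  rewrite addr0 (bigD1 i)//= big1 => [|j /andP[jJ ji]].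
    rewrite addr0 finset.setD11 (sgnD1 i iJ) ltnn mul1r.
    by rewrite (finset.setD1K iJ) mulrA sgn_sqr mul1r.
  by rewrite !inE eq_sym ji iJ/= mulr0.
rewrite (big_setU1 _ iJ)/= sgnU// ltnn mul1r.
rewrite mulrDr mulrA sgn_sqr mul1r finset.setU1K// addrCA mulr_sumr -big_split/=.
rewrite big1 ?addr0// => j jJ.
have ij : i != j by apply: contraNneq iJ => ->.
rewrite !inE (negbTE iJ) andbF.
have -> : (i |: J) :\ j = i |: J :\ j.
  by apply/finset.setP => l; rewrite !inE; case: (eqVneq l i) => [->|//]; rewrite ij.
rewrite (sgnD1 i jJ) (sgnU j iJ) (sign_ltn_neq ij).
have := sqrr_sign R (val j < val i)%N; rewrite expr2.
set e := (-1) ^+ _; move: (sgn i _) (sgn j _) (D j _) => x y z ee.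
by rewrite -[y * _]mul1r -ee; ring.
Qed.

(** * Operators on functions acting on cochains *)

Section Operators.
Variable T : (V -> R) -> V -> R.
Hypothesis T_linear : forall (x y : R) f g, smooth f -> smooth g ->
  T (fun q => x * f q + y * g q) = (fun p => x * T f p + y * T g p).
Hypothesis T_smooth : forall f, smooth f -> smooth (T f).
Hypothesis T_Xf : forall j f, smooth f -> Xf j (T f) = T (Xf j f).

Lemma op0 : T (fun=> 0) = fun=> 0.
Proof.
have s0 := @smooth_cst R _ 0.
have := T_linear 0 0 (s0 _) (s0 _).
under eq_fun do rewrite !mul0r addr0.
by move=> ->; apply/funext => p; rewrite !mul0r addr0.
Qed.

Lemma op_sum (r : seq 'I_n) (P : pred 'I_n) (x : 'I_n -> R) (F : 'I_n -> V -> R) :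
  (forall j, smooth (F j)) ->
  T (fun q => \sum_(j <- r | P j) x j * F j q) =
  (fun p => \sum_(j <- r | P j) x j * T (F j) p).
Proof.
move=> sF; elim: r => [|j r IH].
  under eq_fun do rewrite big_nil; rewrite op0.
  by apply/funext => p; rewrite big_nil.
under eq_fun do rewrite big_cons.
under [RHS]eq_fun do rewrite big_cons.
case: (P j) => //.
have sS : smooth (fun q => \sum_(j <- r | P j) x j * F j q).
  by apply: smooth_sum => l; exact: smoothZ.
have := T_linear (x j) 1 (sF j) sS; rewrite IH.
under eq_fun do rewrite mul1r.
by under [RHS]eq_fun do rewrite mul1r.
Qed.

Lemma dF_op a : smoothc a -> dF (fun J => T (a J)) = (fun J => T (dF a J)).
Proof.
move=> sa; apply/funext => J; rewrite /dF op_sum; last first.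
  by move=> j; exact/smooth_Xf/sa.
by apply/funext => p; apply: eq_bigr => j _; rewrite (T_Xf j (sa _)).
Qed.

Lemma is_form_op k a : is_form k a -> is_form k (fun J => T (a J)).
Proof.
move=> fa J; split=> [kJ|kJ]; first exact/T_smooth/(fa J).1.
by rewrite ((fa J).2 kJ) op0.
Qed.

Lemma closedF_op k a : closedF k a -> closedF k (fun J => T (a J)).
Proof.
move=> [fa da]; split; first exact: is_form_op.
by move=> J; rewrite (dF_op (is_form_smooth fa)) da op0.
Qed.

End Operators.

Lemma sub_avg_exact k i a : closedF k.+1 a -> exists2 b, is_form k b &
  forall J p, a J p = avg i (a J) p + dF b J p.
Proof.
move=> [fa da]; have sa := is_form_smooth fa.
pose Pa : cochain R n := fun J => prim i (a J).
have fP : is_form k.+1 Pa.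
  by apply: is_form_op fa; [exact: prim_linear|exact: smooth_prim].
have dP J : dF Pa J = fun=> 0.
  have E := dF_op (@prim_linear R n i) (@Xf_prim R n i) sa.
  apply: etrans (congr1 (fun h => h J) E) _; rewrite da.
  exact: (op0 (@prim_linear R n i)).
exists (ctr i Pa); first exact: is_form_ctr.
move=> J p; have := cartan i J p (is_form_smooth fP).
have -> : ctr i (dF Pa) J p = 0 by rewrite /ctr dP mulr0; case: ifP.
have -> : Xf i (Pa J) p = a J p - avg i (a J) p.
  exact: (congr1 (fun h => h p) (etrans (Xf_prim i i (sa J)) (prim_Xf i (sa J)))).
by move: (dF _ J p) (avg i (a J) p) => x y; lra.
Qed.

Lemma sub_avgs_exact k s a : closedF k.+1 a -> exists2 b, is_form k b &
  forall J p, a J p = avgs s (a J) p + dF b J p.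
Proof.
move=> ca; elim: s => [|i s [b fb bE]].
  exists (fun _ => fun=> 0); first by move=> J; split=> // _; exact: smooth_cst.
  by move=> J p; rewrite /= dF_Xf0 ?addr0// => j K; apply/funext => q; exact: Xf0.
have ca' : closedF k.+1 (fun J => avgs s (a J)).
  by apply: closedF_op ca;
    [exact: avgs_linear|exact: smooth_avgs|move=> *; exact: Xf_avgs].
have [c fc cE] := sub_avg_exact i ca'.
exists (fun J p => b J p + c J p).
  move=> J; split=> kJ.
    by apply: smoothD; [exact: (fb J).1|exact: (fc J).1].
  by rewrite ((fb J).2 kJ) ((fc J).2 kJ); apply/funext => p; rewrite addr0.
move=> J p; rewrite (dF_add (is_form_smooth fb) (is_form_smooth fc)) bE cE.
by rewrite addrAC addrA.
Qed.

(** * The total average and the map onto the direct sum *)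

Definition Avg f : V -> R := avgs (enum 'I_n) f.

Lemma Avg_linear (x y : R) f g : smooth f -> smooth g ->
  Avg (fun q => x * f q + y * g q) = (fun p => x * Avg f p + y * Avg g p).
Proof. exact: avgs_linear. Qed.

Lemma Avg0 : Avg (fun=> 0) = fun=> 0.
Proof. exact: (op0 Avg_linear). Qed.

Lemma smooth_Avg f : smooth f -> smooth (Avg f).
Proof. exact: smooth_avgs. Qed.

Lemma Xf_Avg j f : smooth f -> Xf j (Avg f) = fun=> 0.
Proof. by move=> sf; apply: Xf_avgs_eq0; rewrite ?mem_enum. Qed.

Lemma Avg_dF b J : smoothc b -> Avg (dF b J) = fun=> 0.
Proof.
move=> sb; have E := dF_op Avg_linear (fun j f => @Xf_avgs R n (enum 'I_n) j f) sb.
apply: etrans (esym (congr1 (fun h => h J) E)) _.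
apply/funext => p; apply: dF_Xf0 => i K; exact: Xf_Avg.
Qed.

Lemma Avg_rotmx f i t p : smooth f -> Avg f (p *m rotmx i t) = Avg f p.
Proof.
move=> sf; apply: (Xf_eq0P i (smooth_Avg sf)).1 => {}p.
exact: (congr1 (fun h => h p) (Xf_Avg i sf)).
Qed.

Lemma Avg_id f : smooth f -> (forall i p, Xf i f p = 0) -> Avg f = f.
Proof.
by move=> sf X0; apply: avgs_invariant => i t p; exact: ((Xf_eq0P i sf).1 (X0 i)).
Qed.

Lemma Wk_closedF k w : Wk k w -> closedF k w.
Proof.
by move=> [fw X0]; split=> // J; apply/funext => p; exact: dF_Xf0.
Qed.

Lemma Wk_Avg k a : is_form k a -> Wk k (fun J => Avg (a J)).
Proof.
move=> fa; split; first by apply: is_form_op fa; [exact: Avg_linear|exact: smooth_Avg].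
by move=> i J; exact/Xf_Avg/(is_form_smooth fa).
Qed.

Definition hh_prod J p : R := \prod_(j <- enum J) hh j p.

Lemma smooth_hh_prod J : smooth (hh_prod J).
Proof. by apply: smooth_prod => j; exact: smooth_hh. Qed.

Lemma hh_prod_rotmx J i t p : hh_prod J (p *m rotmx i t) = hh_prod J p.
Proof. by apply: eq_bigr => j _; exact: hh_rot. Qed.

Lemma hh_prod_Sigma J j p : j \in J -> Sigma j p -> hh_prod J p = 0.
Proof.
move=> jJ [xj yj]; rewrite /hh_prod (big_rem j) ?mem_enum//=.
by rewrite /hh xj yj expr0n/= addr0 mul0r.
Qed.

Lemma function_of_h_Xf g : smooth g ->
  (exists f : 'rV[R]_n -> R, forall p, g p = f (hvec p)) ->
  forall i p, Xf i g p = 0.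
Proof.
move=> sg [f gf] i; apply: (Xf_eq0P i sg).2 => t p.
by rewrite !gf hvec_rot.
Qed.

(** Written on forms rather than on classes: the average kills exact forms, and the factor
    [hh_prod J], nonzero on a dense set, can be cancelled, so a closed form in the kernel has zero
    average. *)
Definition Phi a : cochain R n := fun J p => hh_prod J p * Avg (a J) p.

Lemma summand_Phi f J : smooth f -> summand J (fun p => hh_prod J p * Avg f p).
Proof.
move=> sf; split; [|split].
- by apply: smoothM; [exact: smooth_hh_prod|exact: smooth_Avg].
- by apply: invariant_function_of_h => i t p; rewrite hh_prod_rotmx Avg_rotmx.
- by move=> p [j [jJ jp]]; rewrite (hh_prod_Sigma jJ jp) mul0r.
Qed.

Lemma Phi_dsum k a : closedF k a -> in_dsum k (Phi a).
Proof.
move=> [fa _] J; split=> kJ; first exact/summand_Phi/(fa J).1.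
by apply/funext => p; rewrite /Phi ((fa J).2 kJ) Avg0 mulr0.
Qed.

Lemma Phi_surjective k G : in_dsum k G -> exists a, closedF k a /\ Phi a = G.
Proof.
move=> dG.
(* The third clause makes the chosen [q] vanish off degree [k], as a form of degree [k] requires. *)
have H J : exists q : V -> R, [/\ smooth q, forall i p, Xf i q p = 0,
    #|J| <> k -> q = fun=> 0 & forall p, G J p = hh_prod J p * q p].
  have [kJ|/eqP kJ] := eqVneq #|J| k; last first.
    exists (fun=> 0); split=> //; first exact: smooth_cst.
      by move=> i p; exact: Xf0.
    by move=> p; rewrite mulr0 ((dG J).2 kJ).
  have [sG [fG G0]] := (dG J).1 kJ.
  have [q [sq Xq qE]] := divide_by_prod_hh (enum_uniq (mem J)) sG
    (function_of_h_Xf sG fG)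
    (fun i p iJ ip => G0 p (ex_intro _ i (conj (etrans (esym (mem_enum _ _)) iJ) ip))).
  by exists q; split.
have [a aP] := choice H; exists a; split.
  apply: Wk_closedF; split.
    by move=> J; have [sq _ q0 _] := aP J; split.
  by move=> i J; have [_ Xq _ _] := aP J; apply/funext => p; exact: Xq.
apply/funext => J; apply/funext => p; have [sq Xq _ qE] := aP J.
by rewrite /Phi (Avg_id sq Xq) qE.
Qed.

Lemma Phi_eq0 a J : smoothc a -> Phi a = (fun _ _ => 0) -> Avg (a J) = fun=> 0.
Proof.
move=> sa P0; apply/funext => p.
apply: (@prod_hh_mul_eq0 R n (enum J)).
  exact/smooth_continuous/smooth_Avg/sa.
by move=> q; exact: (congr1 (fun h => h J q) P0).
Qed.

End Cochains.

Theorem mainTheorem9 (R : realType) (n k : nat) (hk1 : (1 <= k)%N) (hkn : (k <= n)%N) :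
  (* ker d_F = W^k_F (+) d_F(Omega^{k-1}_F) *)
  ((forall a : cochain R n, is_form k a ->
      (closedF k a <-> exists w b, Wk k w /\ is_form k.-1 b /\
                                   a = (fun J p => w J p + dF b J p)))
   /\ (forall w : cochain R n, Wk k w -> exactF k w -> w = (fun _ _ => 0)))
  /\
  (* H^k_F = ker / im is isomorphic to the direct sum of the summands:
     a linear surjection from ker d_F onto the direct sum with kernel im d_F *)
  (exists Phi : cochain R n -> cochain R n,
     (forall a, closedF k a -> in_dsum k (Phi a)) /\
     (forall (c1 c2 : R) a1 a2, closedF k a1 -> closedF k a2 ->
        Phi (fun J p => c1 * a1 J p + c2 * a2 J p) =
        (fun J p => c1 * Phi a1 J p + c2 * Phi a2 J p)) /\
     (forall G, in_dsum k G -> exists a, closedF k a /\ Phi a = G) /\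
     (forall a, closedF k a -> (Phi a = (fun _ _ => 0) <-> exactF k a))).
Proof.
(* With the degree written as a successor, its predecessor is the degree of the primitives built
   above. *)
case: k hk1 hkn => // k _ _; split; [split|].
- move=> a fa; split=> [ca|[w [b [ww [fb aE]]]]].
    have [b fb aE] := sub_avgs_exact (enum 'I_n) ca.
    exists (fun J => Avg (a J)), b; split; first exact: Wk_Avg.
    by split=> //; apply/funext => J; apply/funext => p; exact: aE.
  split=> // J; have [fw dw] := Wk_closedF ww; have sb := is_form_smooth fb.
  rewrite aE (dF_add (is_form_smooth fw) (smoothc_dF sb)) dw.
  by apply/funext => p; rewrite add0r; exact: dF_dF.
(* An element of [Wk] equals its average, while the average of [dF b] is zero. *)
- move=> w [fw Xw] [b [fb wE]]; apply/funext => J.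
  have sw := is_form_smooth fw J.
  have W : Avg (w J) = w J.
    by apply: (Avg_id sw) => i p; exact: (congr1 (fun h => h p) (Xw i J)).
  by rewrite -W wE; exact: (Avg_dF J (is_form_smooth fb)).
- exists (@Phi R n); split; first exact: Phi_dsum.
  split; [|split; first exact: Phi_surjective].
    move=> c1 c2 a1 a2 [f1 _] [f2 _]; apply/funext => J; apply/funext => p.
    rewrite /Phi (Avg_linear _ _ (is_form_smooth f1 J) (is_form_smooth f2 J)).
    by rewrite mulrDr mulrCA [X in _ + X]mulrCA.
  move=> a ca; have [fa _] := ca; split=> [P0|[b [fb aE]]].
    have [b fb aE] := sub_avgs_exact (enum 'I_n) ca.
    exists b; split=> //; apply/funext => J; apply/funext => p.
    apply: etrans (aE J p) _; have A0 := Phi_eq0 J (is_form_smooth fa) P0.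
    by rewrite [avgs _ _ p](congr1 (fun h => h p) A0) add0r.
  apply/funext => J; apply/funext => p.
  by rewrite /Phi aE (Avg_dF J (is_form_smooth fb)) mulr0.
Qed.
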